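(* Let $(s_n^i)_n$ be a tame sequence on $X^i$, with associated (normalized) functions $\varrho_n^i$ and limit $\varrho^i$ on $X^i$ as in the context. Let $W^i\subset\pi(X^i)$ be a compact neighborhood such that $(\varrho^i\times\pi)|\pi^{-1}(W^i)$ is proper, let $\epsilon>0$ and let $\delta>0$. Then there exists $N_0\in\mathbb N$ such that $$\varrho_n^i(x)\ge\epsilon-\delta$$ for all $x\in T^c(\epsilon,W^i)=(\varrho^i\times\pi)^{-1}([\epsilon,\infty)\times W^i)$ and all $n\ge N_0$.
   Context: Setting. $X$ is a normal projective complex variety of pure dimension. $\mathbb T=T^{\mathbb C}$ is the complexification of a compact torus $T\cong(S^1)^r$ with Lie algebra $\mathfrak t$, acting algebraically on $X$. $p:L\to X$ is a base point free line bundle with an algebraic $\mathbb T$-action covering the action on $X$ and linear on fibers. $h$ is a smooth, positive, $T$-invariant hermitian metric on $L$; $|\cdot|$ is the induced norm on $L$, on its powers and on sections. $\omega$ is the Kähler form with $p^*\omega=-\frac i2\partial\bar\partial\log|\cdot|^2$ and $\mu:X\to\mathfrak t^*$ the moment map given by $p^*\mu^\eta=-\frac14 d^c\log|\cdot|^2(\widehat X_\eta)$, where $\widehat X_\eta$ is the fundamental vector field of $\eta\in\mathfrak t$ on $L$. Weights. $s\in H^0(X,L^n)$ is a $\chi$-eigensection ($\chi\in\mathfrak t^*_{\mathbb Z}$) if $\exp(\eta).s=e^{2\pi\sqrt{-1}\chi(\eta)}s$ for $\eta\in\mathfrak t$; weights are viewed in $\mathfrak t^*$ in the normalization compatible with $\mu$: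 $\mu(x)=\chi/n$ whenever $x$ is a $\mathbb T$-fixed point and $s$ is a $\chi$-eigensection of $L^n$ with $s(x)\ne0$. Quotient. Fix $\xi\in\mathrm{Im}(\mu)$. $X^{ss}_\xi=\{x\in X:\mathrm{cl}(\mathbb T.x)\cap\mu^{-1}(\xi)\ne\varnothing\}$ and $\pi:X^{ss}_\xi\to Y:=X^{ss}_\xi/\!\!/\mathbb T$ is the Hilbert quotient: $\pi(x)=\pi(y)$ iff $\mathrm{cl}(\mathbb T.x)\cap\mathrm{cl}(\mathbb T.y)\neq\varnothing$ (closures in $X^{ss}_\xi$), and $(\pi_*\mathcal O_{X^{ss}_\xi})^{\mathbb T}=\mathcal O_Y$. $Y$ is compact and normal; each fiber of $\pi$ meets $\mu^{-1}(\xi)$ in exactly one $T$-orbit. Tame sequences. A tame collection is a finite cover $\{X^i\}_{i\in I}$ of $X^{ss}_\xi$ by open $\pi$-saturated subsets together with sequences of $\mathbb T$-eigensections $s_n^i\in H^0(X,L^n)$ of weights $\xi_n^i$ such that (1) $\xi_n^i/n\to\xi$ with $|\xi_n^i-n\xi|\in\mathcal O(1)$; (2) $X^i\subset\{s_n^i\ne0\}$ for all $n$ big enough; (3) $X^i\cap\mathbb T.\mu^{-1}(\xi)=X^i\cap\mathbb T.\mu^{-1}(\xi_n^i/n)$ for all $n$ big enough. Each $(s_n^i)_n$ is called a tame sequence. Potentials and tubes. Put $\rho_n=-\frac1n\log|s_n^i|^2$ on $X^i$. For the tame sequences considered, $\rho_n$ converges, uniformly on compact subsets of $X^i$ together with all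 derivatives, to a smooth strictly plurisubharmonic function $\rho$ on $X^i$. For a $T$-invariant function $u$ on $X^i$ let $u_{red}$ be the function on $\pi(X^i)$ whose value at $y$ is the value of $u$ on $\mu^{-1}(\xi)\cap\pi^{-1}(y)$. The normalized functions are $\varrho_n^i:=\rho_n-\pi^*(\rho_n)_{red}$ and $\varrho^i:=\rho-\pi^*\rho_{red}\ge0$. Every point of $\pi(X^i)$ has a compact neighborhood $W^i\subset\pi(X^i)$ for which $(\varrho^i\times\pi):\pi^{-1}(W^i)\to\mathbb R^{\ge0}\times W^i$ is proper. *)

(* Defs.v *)
From HB Require Import structures.
From mathcomp Require Import -(notations) mpoly.
From mathcomp Require Import all_boot all_order all_algebra.
From mathcomp Require Import generic_quotient complex.
From mathcomp Require Import all_classical all_reals all_analysis.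

Set Implicit Arguments.
Unset Strict Implicit.
Unset Printing Implicit Defensive.

Import Order.TTheory GRing.Theory Num.Theory.
Import numFieldNormedType.Exports.
Local Open Scope classical_set_scope.
Local Open Scope ring_scope.
Local Open Scope complex_scope.
Local Open Scope quotient_scope.

(* The regular module carries the topology that R[i] itself lacks. *)
Notation Cx R := ((R[i])^o).

Definition modulus (R : realType) (z : Cx R) : R := Normc.normc z.

Definition cexp (R : realType) (z : Cx R) : Cx R :=
  (expR (complex.Re z))%:C * (cos (complex.Im z) +i* sin (complex.Im z)).

Section ProjectiveSpace.
Context (R : realType) (N : nat).

Definition nonzero_vec : Type := {z : 'rV[Cx R]_N.+1 | z != 0}.
Definition nonzero_val (z : nonzero_vec) : 'rV[Cx R]_N.+1 := sval z.

HB.instance Definition _ := SubChoice.on nonzero_vec.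
HB.instance Definition _ :=
  Topological.copy nonzero_vec (initial_topology nonzero_val).

(* equality of row spaces, i.e. z and w span the same line *)
Let same_line (z w : nonzero_vec) : bool := (nonzero_val z == nonzero_val w)%MS.

Local Lemma same_line_refl : reflexive same_line.
Proof. by move=> z; rewrite /same_line !submx_refl. Qed.

Local Lemma same_line_sym : symmetric same_line.
Proof. by move=> z w; rewrite /same_line andbC. Qed.

Local Lemma same_line_trans : transitive same_line.
Proof.
move=> w z u /andP[zw wz] /andP[wu uw].
by rewrite /same_line (submx_trans zw wu) (submx_trans uw wz).
Qed.

Definition line_rel :=
  EquivRel _ same_line_refl same_line_sym same_line_trans.

Definition proj_space : Type := {eq_quot line_rel}.
HB.instance Definition _ := Quotient.on proj_space.
HB.instance Definition _ :=
  Topological.copy proj_space (quotient_topology proj_space).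

Lemma const1_neq0 : (const_mx 1 : 'rV[Cx R]_N.+1) != 0.
Proof.
by apply/eqP => /matrixP/(_ 0 0); rewrite !mxE; apply/eqP; exact: oner_neq0.
Qed.

(* [z_0 : ... : z_N]; the value at z = 0 is irrelevant *)
Definition pt (z : 'rV[Cx R]_N.+1) : proj_space :=
  \pi_proj_space (insubd (Sub (const_mx 1) const1_neq0 : nonzero_vec) z).

Definition hcoord (x : proj_space) : 'rV[Cx R]_N.+1 := nonzero_val (repr x).

Definition chart (k : 'I_N.+1) (a : 'rV[Cx R]_N) : proj_space :=
  pt (\row_j (if unlift k j is Some i then a 0 i else 1)).
End ProjectiveSpace.

Section Varieties.
Context (R : realType) (N : nat).
Local Notation P := (proj_space R N).
Implicit Types (X U Z : set P) (x y : P) (f g : P -> Cx R).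

Definition homog (K : nzRingType) (d : nat) (p : mpoly.mpoly N.+1 K) : Prop :=
  p \is mpoly.ishomog1 d mpoly.mdeg.

(* Evaluation at a representative: for p homogeneous of degree d this depends
   on the representative up to the d-th power of a nonzero scalar only, so that
   vanishing, and quotients of two forms of equal degree, are well defined. *)
Definition ev (p : mpoly.mpoly N.+1 (Cx R)) x : Cx R :=
  mpoly.meval (fun j => hcoord x 0 j) p.

Definition zclosed Z := exists S : set (mpoly.mpoly N.+1 (Cx R)),
  (forall p, S p -> exists d, homog d p) /\
  Z = [set x | forall p, S p -> ev p x = 0].

Definition zopen_in X U := exists2 Z, zclosed Z & U = X `\` Z.

Definition irreducible Z := [/\ zclosed Z, Z !=set0 &
  forall A B, zclosed A -> zclosed B -> Z `<=` A `|` B ->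
    Z `<=` A \/ Z `<=` B].

Definition irr_component X Z := [/\ irreducible Z, Z `<=` X &
  forall Z', irreducible Z' -> Z `<=` Z' -> Z' `<=` X -> Z' = Z].

(* Krull dimension, by strict chains of irreducible closed subsets *)
Definition dim_ge Z (d : nat) := exists c : nat -> set P,
  [/\ forall i, (i <= d)%N -> irreducible (c i),
      forall i, (i < d)%N -> c i `<` c i.+1 & c d `<=` Z].

Definition pure_dimensional X := exists d,
  forall Z, irr_component X Z -> dim_ge Z d /\ ~ dim_ge Z d.+1.

Definition regular_on U f := forall x, U x ->
  exists d (p q : mpoly.mpoly N.+1 (Cx R)),
  [/\ homog d p, homog d q, ev q x != 0 &
      forall y, U y -> ev q y != 0 -> f y = ev p y / ev q y].

(* The local ring of X at x is represented by functions regular near x, modulo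
   equality near x. *)
Definition regular_at X x f :=
  exists U, [/\ zopen_in X U, U x & regular_on U f].

Definition germ_eq X x f g :=
  exists U, [/\ zopen_in X U, U x & forall y, U y -> f y = g y].

(* The local ring is a domain, and a fraction a / b integral over it (the
   equation being cleared of denominators) belongs to it. *)
Definition normal_at X x :=
  (forall f g, regular_at X x f -> regular_at X x g ->
     germ_eq X x (fun y => f y * g y) (fun=> 0) ->
     germ_eq X x f (fun=> 0) \/ germ_eq X x g (fun=> 0)) /\
  (forall a b, regular_at X x a -> regular_at X x b ->
     ~ germ_eq X x b (fun=> 0) ->
     (exists k (c : 'I_k -> P -> Cx R), (forall i, regular_at X x (c i)) /\
        germ_eq X x
          (fun y => a y ^+ k + \sum_(i < k) c i y * a y ^+ i * b y ^+ (k - i))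
          (fun=> 0)) ->
     exists2 e, regular_at X x e & germ_eq X x a (fun y => e y * b y)).

Definition normal X := forall x, X x -> normal_at X x.
End Varieties.

Section AffineCalculus.
Context (R : realType) (N : nat).
Local Notation V := 'rV[Cx R]_N.
Implicit Types (Om : set V) (u : V -> R) (v z : V).

Definition dir_deriv v u z : R :=
  derive1 (fun t : R => u (z + (t%:C : Cx R) *: v)) 0.

Definition dir_derivs (vs : seq V) u : V -> R := foldr dir_deriv u vs.

Fixpoint Ck (k : nat) Om u : Prop :=
  (forall z, Om z -> {for z, continuous u}) /\
  if k is k'.+1 then forall v,
    (forall z, Om z -> derivable (fun t : R => u (z + (t%:C : Cx R) *: v)) 0 1)
    /\ Ck k' Om (dir_deriv v u)
  else True.

Definition smooth Om u := forall k, Ck k Om u.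

(* sum_(j,k) (d^2 u / dz_j dzbar_k) v_j vbar_k *)
Definition levi_form u z v : R :=
  4^-1 * (dir_deriv v (dir_deriv v u) z
          + dir_deriv ('i%C *: v) (dir_deriv ('i%C *: v) u) z).

Definition strictly_psh Om u :=
  forall z v, Om z -> v != 0 -> 0 < levi_form u z v.

Definition holomorphic Om (F : V -> Cx R) :=
  (forall z, Om z -> {for z, continuous F}) /\ forall z v, Om z -> derivable F z v.
End AffineCalculus.

(* On a (possibly singular) locally closed analytic subset U of P^N these
   notions mean: locally the restriction of such a function on an open subset
   of an affine chart. *)
Section SingularCalculus.
Context (R : realType) (N : nat).
Local Notation P := (proj_space R N).
Local Notation V := 'rV[Cx R]_N.
Implicit Types (U : set P).

Definition locally_extends (T : Type) U (E : set V -> (V -> T) -> Prop)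
    (f : P -> T) :=
  forall k a, U (chart k a) -> exists Om F,
    [/\ open Om, Om a, E Om F &
        forall z, Om z -> U (chart k z) -> F z = f (chart k z)].

Definition smooth_spsh_on U (f : P -> R) := locally_extends U
  (fun Om u => smooth Om u /\ strictly_psh Om u) f.

Definition holomorphic_on U (f : P -> Cx R) :=
  locally_extends U (@holomorphic R N) f.

(* f_n --> f uniformly on compact subsets of U together with all derivatives *)
Definition cvg_smooth U (fn : nat -> P -> R) (f : P -> R) :=
  (forall K, compact K -> K `<=` U -> {uniform K, fn @ \oo --> f}) /\
  forall k a, U (chart k a) -> exists Om (un : nat -> V -> R) (u : V -> R),
    [/\ open Om /\ Om a,
        \forall n \near \oo, smooth Om (un n) /\
          forall z, Om z -> U (chart k z) -> un n z = fn n (chart k z),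
        smooth Om u /\
          forall z, Om z -> U (chart k z) -> u z = f (chart k z) &
        forall vs K, compact K -> K `<=` Om ->
          {uniform K, (fun n => dir_derivs vs (un n)) @ \oo
                      --> dir_derivs vs u}].
End SingularCalculus.

(* T^C is identified with (C^x)^r, its compact form T with (S^1)^r, the Lie
   algebra of T and its dual with R^r, the lattice of weights being Z^r. *)
Section Torus.
Context (R : realType) (N r : nat).
Local Notation P := (proj_space R N).
Local Notation TT := 'rV[Cx R]_r.
Implicit Types (X : set P) (t s : TT) (act : TT -> P -> P).

Definition torus : set TT := [set t | forall j, t 0 j != 0].
Definition ctorus : set TT := [set t | forall j, modulus (t 0 j) = 1].
Definition tmul t s : TT := \row_j (t 0 j * s 0 j).
Definition tone : TT := const_mx 1.

(* exp : Lie(T^C) -> T^C, with kernel the lattice Z^r in Lie(T) *)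
Definition texp (zeta : TT) : TT :=
  \row_j cexp ((2 * pi)%:C * 'i%C * zeta 0 j).

Definition pairing (a : 'rV[R]_r) (eta : 'rV[R]_r) : R :=
  \sum_j a 0 j * eta 0 j.

(* Polynomials in the coordinates of T^C with homogeneous polynomials in those
   of P^N; negative powers of the coordinates of T^C are cleared. *)
Definition evT (p : mpoly.mpoly N.+1 (mpoly.mpoly r (Cx R))) t (x : P) : Cx R :=
  mpoly.meval (fun j => hcoord x 0 j)
    (mpoly.map_mpoly (mpoly.meval (fun j => t 0 j)) p).

Definition regular_onT (D : set (TT * P)) (f : TT -> P -> Cx R) :=
  forall t x, D (t, x) -> exists d p q,
  [/\ @homog N _ d p, @homog N _ d q, evT q t x != 0 &
      forall s y, D (s, y) -> evT q s y != 0 -> f s y = evT p s y / evT q s y].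

Record algebraic_action X act : Prop := {
  act_stable : forall t x, torus t -> X x -> X (act t x);
  act_one : forall x, X x -> act tone x = x;
  act_mul : forall t s x, torus t -> torus s -> X x ->
    act (tmul t s) x = act t (act s x);
  act_regular : forall t x, torus t -> X x ->
    exists d (F : 'I_N.+1 -> mpoly.mpoly N.+1 (mpoly.mpoly r (Cx R))),
    [/\ forall j, homog d (F j), exists j, evT (F j) t x != 0 &
        forall s y, torus s -> X y -> (exists j, evT (F j) s y != 0) ->
          act s y = pt (\row_j evT (F j) s y)] }.

Definition orbit act (x : P) : set P := [set act t x | t in torus].
Definition sweep act (A : set P) : set P := \bigcup_(x in A) orbit act x.
End Torus.

Section LineBundles.
Context (R : realType) (N r : nat) (X : set (proj_space R N)).
Local Notation P := (proj_space R N).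
Local Notation TT := 'rV[Cx R]_r.

(* A geometric line bundle: total space, projection, and trivializations, whose
   restrictions to fibers are bijections onto C differing by regular factors. *)
Record line_bundle := LineBundle {
  tot : Type;
  prj : tot -> P;
  tidx : finType;
  tdom : tidx -> set P;
  triv : tidx -> tot -> Cx R;
  prj_in : forall v, X (prj v);
  tdom_open : forall a, zopen_in X (tdom a);
  tdom_cover : X `<=` \bigcup_a tdom a;
  triv_bij : forall a x c, tdom a x -> exists! v, prj v = x /\ triv a v = c;
  triv_change : forall a b, exists2 g : P -> Cx R,
    regular_on (tdom a `&` tdom b) g &
    forall v, tdom a (prj v) -> tdom b (prj v) ->
      triv a v = g (prj v) * triv b v }.

Variable L : line_bundle.
Implicit Types (v : tot L) (a b : tidx L).

Definition nonzero v := forall a, tdom a (prj v) -> triv a v != 0.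

(* A section of L^n is given by its coefficients in the frames induced by the
   trivializations; (triv a v)^n is the coordinate of the n-th tensor power of
   v, so that sec_glue is the transformation rule s_a = (g_ab)^n s_b. *)
Record section (n : nat) := Section {
  coef : tidx L -> P -> Cx R;
  coef_regular : forall a, regular_on (tdom a) (coef a);
  sec_glue : forall a b v, tdom a (prj v) -> tdom b (prj v) ->
    coef a (prj v) * triv b v ^+ n = coef b (prj v) * triv a v ^+ n }.

Definition nonvanishing n (s : section n) (x : P) :=
  exists2 a, tdom a x & coef s a x != 0.

Definition base_point_free :=
  forall x, X x -> exists s : section 1, nonvanishing s x.

Record linearization (act : TT -> P -> P) (actL : TT -> tot L -> tot L) : Prop
:= {
  lin_covers : forall t v, torus t -> prj (actL t v) = act t (prj v);
  lin_one : forall v, actL (tone R r) v = v;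
  lin_mul : forall t s v, torus t -> torus s ->
    actL (tmul t s) v = actL t (actL s v);
  lin_regular : forall a b, exists2 j : TT -> P -> Cx R,
    regular_onT [set tx | [/\ torus tx.1, tdom a tx.2 &
                              tdom b (act tx.1 tx.2)]] j &
    forall t v, torus t -> tdom a (prj v) -> tdom b (act t (prj v)) ->
      triv b (actL t v) = j t (prj v) * triv a v }.

Section Action.
Variables (act : TT -> P -> P) (actL : TT -> tot L -> tot L).

Definition weight_val (chi : 'rV[int]_r) (eta : 'rV[R]_r) : R :=
  \sum_j (chi 0 j)%:~R * eta 0 j.

(* exp(eta).s = e^(2 pi i chi(eta)) s for (t.s)(x) = t.(s(t^-1.x)). At a point
   t.x, multiplied by the coordinate (triv a v)^n with v in L_x, it says that
   t.(s(x)) = e^(2 pi i chi(eta)) s(t.x). *)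
Definition eigensection n (s : section n) (chi : 'rV[int]_r) :=
  forall (eta : 'rV[R]_r) a b v,
    let t := texp (map_mx (fun c : R => c%:C : Cx R) eta) in
    tdom a (prj v) -> tdom b (act t (prj v)) ->
    coef s a (prj v) * triv b (actL t v) ^+ n =
    cexp ((2 * pi * weight_val chi eta)%:C * 'i%C)
      * coef s b (act t (prj v)) * triv a v ^+ n.

(* nrm is the norm v |-> |v|, and phi is - log of the squared norm of the frame
   over tdom a, so that omega = i/2 d dbar phi for the form omega with
   p^* omega = - i/2 d dbar log|.|^2; phi being strictly plurisubharmonic says
   that omega is a Kaehler form, i.e. that the metric is positive. *)
Record hermitian_metric (nrm : tot L -> R) : Prop := {
  nrm_ge0 : forall v, 0 <= nrm v;
  nrm_smooth_positive : forall a, exists2 phi : P -> R,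
    smooth_spsh_on (tdom a) phi &
    forall v, tdom a (prj v) ->
      nrm v ^+ 2 = modulus (triv a v) ^+ 2 * expR (- phi (prj v));
  nrm_invariant : forall t v, ctorus t -> nrm (actL t v) = nrm v }.

(* p^* mu^eta = - 1/4 d^c log|.|^2 (X_eta) with d^c f = df o J. As X_eta at v is
   the velocity of exp(s eta).v, its image under J is that of exp(i s eta).v. *)
Definition moment_map (nrm : tot L -> R) (mu : P -> 'rV[R]_r) :=
  forall v (eta : 'rV[R]_r), nonzero v ->
    pairing (mu (prj v)) eta = - 4^-1 *
      derive1 (fun s : R => ln (nrm (actL (texp (map_mx (fun c : R =>
         (s * c)%:C * 'i%C : Cx R) eta)) v) ^+ 2)) 0.
End Action.

(* A weight in the normalization compatible with mu: if x is fixed and an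
   eigensection of L^n of weight chi does not vanish at x, then exp(i s eta) acts
   on L_x by exp(- 2 pi s chi(eta) / n), whence mu(x) = pi chi / n. *)
Definition weight_vec (chi : 'rV[int]_r) : 'rV[R]_r :=
  \row_j (pi * (chi 0 j)%:~R).

(* The norm of s(x): its coefficient in the frame n-th power of v is coef s a x,
   and the value does not depend on a, so that the set is a singleton. *)
Definition sec_norm (nrm : tot L -> R) n (s : section n) (x : P) : R :=
  get [set c : R | exists a v, [/\ tdom a x, prj v = x, triv a v = 1 &
                                   c = modulus (coef s a x) * nrm v ^+ n]].

Definition potential (nrm : tot L -> R) n (s : section n) (x : P) : R :=
  - n%:R^-1 * ln (sec_norm nrm s x ^+ 2).
End LineBundles.

Section Quotient.
Context (R : realType) (N r : nat).
Local Notation P := (proj_space R N).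
Local Notation TT := 'rV[Cx R]_r.
Variables (X : set P) (act : TT -> P -> P) (mu : P -> 'rV[R]_r).
Variable xi : 'rV[R]_r.

Definition mu_fiber (a : 'rV[R]_r) : set P := X `&` mu @^-1` [set a].

Definition semistable : set P :=
  [set x | X x /\ closure (orbit act x) `&` mu_fiber xi !=set0].

Variables (Y : topologicalType) (q : P -> Y).

(* Only the values of q on the semistable set matter. OY V is the set of
   sections over V of the structure sheaf of Y (as functions on Y, whose values
   outside V are irrelevant); the two sheaf conditions identify it with the
   invariant holomorphic functions on q^-1(V). That each fiber of q meets
   mu^-1(xi) in exactly one T-orbit is what makes [reduced] below meaningful for
   T-invariant functions. *)
Record hilbert_quotient (OY : set Y -> set (Y -> Cx R)) : Prop := {
  hq_surj : q @` semistable = setT;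
  hq_fibers : forall x y, semistable x -> semistable y ->
    (q x = q y <->
     closure (orbit act x) `&` closure (orbit act y) `&` semistable !=set0);
  hq_topology : forall V : set Y, open V <->
    exists2 O : set P, open O & semistable `&` q @^-1` V = semistable `&` O;
  hq_sheaf : forall (V : set Y) (f : Y -> Cx R), open V ->
    (OY V f <-> holomorphic_on (semistable `&` q @^-1` V) (f \o q));
  hq_sheaf_inv : forall (V : set Y) (F : P -> Cx R), open V ->
    holomorphic_on (semistable `&` q @^-1` V) F ->
    (forall t x, torus t -> semistable x -> V (q x) -> F (act t x) = F x) ->
    exists2 f, OY V f & forall x, semistable x -> V (q x) -> F x = f (q x);
  hq_zero_fiber : forall y, exists2 x, mu_fiber xi x &
    semistable `&` q @^-1` [set y] `&` mu_fiber xi =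
    [set act t x | t in @ctorus R r] }.

Definition reduced (u : P -> R) (y : Y) : R :=
  get (u @` (mu_fiber xi `&` semistable `&` q @^-1` [set y])).

Definition normalized (u : P -> R) (x : P) : R := u x - reduced u (q x).

(* (u x q) : D `&` q^-1(W) -> R_{>=0} x W is proper *)
Definition proper_over (D : set P) (u : P -> R) (W : set Y) :=
  forall K : set (R * Y)%type, compact K -> K `<=` `[0, +oo[ `*` W ->
    compact [set x | [/\ D x, W (q x) & K (u x, q x)]].

Definition tube_compl (D : set P) (u : P -> R) (eps : R) (W : set Y) : set P :=
  [set x | [/\ D x, W (q x) & eps <= u x]].
End Quotient.

Record tame_collection (R : realType) (N r : nat) (X : set (proj_space R N))
  (act : 'rV[Cx R]_r -> proj_space R N -> proj_space R N)
  (L : line_bundle X) (actL : 'rV[Cx R]_r -> tot L -> tot L)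
  (mu : proj_space R N -> 'rV[R]_r) (xi : 'rV[R]_r)
  (Y : topologicalType) (q : proj_space R N -> Y)
  (I : finType) (Xi : I -> set (proj_space R N))
  (s : I -> forall n, section L n) (chi : I -> nat -> 'rV[int]_r) : Prop := {
  tame_cover : semistable X act mu xi = \bigcup_i Xi i;
  tame_open : forall i, exists2 O : set (proj_space R N), open O &
    Xi i = semistable X act mu xi `&` O;
  tame_saturated : forall i x y, Xi i x -> semistable X act mu xi y ->
    q x = q y -> Xi i y;
  tame_eigen : forall i n, eigensection act actL (s i n) (chi i n);
  tame_cvg : forall i,
    (fun n => n%:R^-1 *: weight_vec R (chi i n)) @ \oo --> xi;
  tame_bounded : forall i, exists B : R, forall n,
    `|weight_vec R (chi i n) - n%:R *: xi| <= B;
  tame_nonvanishing : forall i, \forall n \near \oo,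
    forall x, Xi i x -> nonvanishing (s i n) x;
  tame_sweep : forall i, \forall n \near \oo,
    Xi i `&` sweep act (mu_fiber X mu xi) =
    Xi i `&` sweep act (mu_fiber X mu (n%:R^-1 *: weight_vec R (chi i n))) }.

(* Main.v *)
Require Import Defs.
From mathcomp Require Import -(notations) mpoly.
From mathcomp Require Import all_boot all_order all_algebra.
From mathcomp Require Import generic_quotient complex ring lra.
From mathcomp Require Import all_classical all_reals all_analysis.

Import Order.TTheory GRing.Theory Num.Theory.
Import numFieldNormedType.Exports.
Local Open Scope classical_set_scope.
Local Open Scope ring_scope.
Local Open Scope quotient_scope.
Local Notation Re := complex.Re.
Local Notation Im := complex.Im.

(** A point x of the tube complement is compared with a point z of mu^-1(xi) in
    the closure of its orbit ([semistable_limit]): reduced functions take on the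
    fiber of x their value at z ([reducedE]), so the claim is that rho_n exceeds
    its value at z by eps - delta at x. Since x degenerates to z, some element
    of the torus moves x so close to z that rho and rho_n are there less than
    eps / 2 above their values at z, and by invariance under the compact torus
    this element can be taken of the form exp(i b).

    Consider the path exp(i t b).x for t from 0 to 1. The limit potential rho is
    at least eps above rho(z) at its start and less than eps above it at its
    end, so it is exactly eps above it at some point p of the path. This point
    lies in the part of the tube over W where the normalized rho is between 0
    and eps, a compact set that depends neither on x nor on n. On it rho_n is
    uniformly close to rho, so rho_n(p) is at least eps - delta above rho_n(z),
    and therefore, delta being at most eps / 2 without loss of generality,
    larger than the value of rho_n at the end of the path. But
    rho_n is convex along the path, hence bounded at p by the larger of its
    values at the two ends ([potential_max_at_endpoint]): the larger value is
    rho_n(x).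

    The convexity is where positivity of the metric enters. The function
    h(w) = rho_n(exp(w b).y) is subharmonic, as rho_n is locally the difference
    of a plurisubharmonic function and 1/n times the logarithm of the squared
    modulus of a nonvanishing holomorphic function; it does not depend on the
    real part of w, by invariance under the compact torus; so it is convex in
    the imaginary part. Subharmonicity is used in a discrete form: the sum of
    h over the points e, -e, ie and -ie is at least 4 h(0) - o(e^2), from which
    the two real points drop out and leave a lower bound -o(e^2) on the second
    difference along the path ([potential_submean]). A function with such lower
    bounds satisfies the maximum principle on a segment ([max_at_endpoint]).

    The four-point inequality is obtained without a chain rule of second order.
    Homogeneous coordinates of exp(w b).y are polynomials in exponentials of w
    ([action_curve]), and have expansions to second order in w ([jet]). The first
    and second powers of the four points having sum zero, the four-point sum of
    a smooth function along the curve is given up to o(e^2) by its value and its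
    Levi form on the tangent vector ([spsh_submean]), and the one of the
    logarithm of the modulus of a nonvanishing function with such an expansion
    by its value at 0 alone ([log_modulus_mean]). *)

(** * Modulus and topology of the complex numbers *)

Section Modulus.
Context {R : realType}.
Local Notation C := (Cx R).
Implicit Types (z w : C).

Lemma modulusM z w : modulus (z * w) = modulus z * modulus w.
Proof. exact: Normc.normcM. Qed.

Lemma modulusD z w : modulus (z + w) <= modulus z + modulus w.
Proof. exact: le_normcD. Qed.

Lemma modulusN z : modulus (- z) = modulus z.
Proof. exact: normcN. Qed.

Lemma modulusV z : modulus z^-1 = (modulus z)^-1.
Proof. exact: Normc.normcV. Qed.

Lemma modulus0 : modulus (0 : C) = 0.
Proof. exact: Normc.normc0. Qed.

Lemma modulus1 : modulus (1 : C) = 1.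
Proof. exact: Normc.normc1. Qed.

Lemma modulus_ge0 z : 0 <= modulus z.
Proof. by case: z => a b; exact: sqrtr_ge0. Qed.

Lemma modulus_eq0 z : (modulus z == 0) = (z == 0).
Proof.
apply/eqP/eqP => [|->]; [exact: Normc.eq0_normc|exact: modulus0].
Qed.

Lemma modulus_gt0 z : (0 < modulus z) = (z != 0).
Proof. by rewrite lt_def modulus_ge0 andbT modulus_eq0. Qed.

Lemma modulusX z k : modulus (z ^+ k) = modulus z ^+ k.
Proof.
by elim: k => [|k IH]; rewrite ?modulus1// !exprS modulusM IH.
Qed.

Lemma modulus_real (x : R) : modulus (x%:C%C : C) = `|x|.
Proof. by rewrite /modulus /= expr0n /= addr0 sqrtr_sqr. Qed.

Lemma modulus_dist z w : `|modulus z - modulus w| <= modulus (z - w).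
Proof.
have H (a b : C) : modulus a - modulus b <= modulus (a - b).
  by rewrite lerBlDr -[in leLHS](subrK b a) modulusD.
by rewrite ler_norml H andbT lerNl opprB -(modulusN (z - w)) opprB H.
Qed.

Lemma modulus_Re z : `|Re z| <= modulus z.
Proof.
case: z => a b; rewrite /modulus /= -sqrtr_sqr ler_wsqrtr//.
by rewrite lerDl sqr_ge0.
Qed.

Lemma modulus_Im z : `|Im z| <= modulus z.
Proof.
case: z => a b; rewrite /modulus /= -sqrtr_sqr ler_wsqrtr//.
by rewrite lerDr sqr_ge0.
Qed.

Lemma realCD (x y : R) : ((x + y)%:C%C : C) = x%:C%C + y%:C%C.
Proof. by rewrite -[RHS]/((x + y) +i* (0 + 0))%C addr0. Qed.

Lemma realCM (x y : R) : ((x * y)%:C%C : C) = x%:C%C * y%:C%C.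
Proof.
by apply/eqP; rewrite eq_complex /=; apply/andP; split; apply/eqP; ring.
Qed.

Lemma ReD z w : Re (z + w) = Re z + Re w.
Proof. by case: z w => a b []. Qed.

Lemma ImD z w : Im (z + w) = Im z + Im w.
Proof. by case: z w => a b []. Qed.

Lemma nbhs_CxP z (A : set C) :
  nbhs z A <-> exists2 d : R, 0 < d & forall w, modulus (w - z) < d -> A w.
Proof.
split => [/nbhs_ballP[e /= e0 zA]|[d d0 dA]].
  have er : e = (Re e)%:C%C by rewrite RRe_real// gtr0_real.
  exists (Re e); first by rewrite -ltcR -er.
  move=> w wz; apply: zA; rewrite -ball_normE /= er.
  rewrite -modulusN opprB in wz.
  by rewrite -ltcR in wz.
apply/nbhs_ballP; exists (d%:C%C); first by rewrite /= ltcR.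
move=> w; rewrite -ball_normE /= => zw; apply: dA.
by rewrite -modulusN opprB -ltcR.
Qed.

End Modulus.

(** * Second-order expansions along the real and imaginary axes *)

Section Jets.
Context {R : realType}.
Local Notation C := (Cx R).
Implicit Types (f g r : C -> C) (z w : C).

(** Small w that are real or purely imaginary. The expansions below are only
    ever evaluated at such w, and there the complex exponential is either a
    real exponential or a pair of a cosine and a sine, whose expansions are
    one-variable calculus. *)
Definition axes0 : set_system C :=
  within [set w | Re w = 0 \/ Im w = 0] (nbhs (0 : C)).

Global Instance axes0_filter : Filter axes0.
Proof. exact: within_filter. Qed.

Lemma axes0P (A : set C) :
  axes0 A <-> exists2 d : R, 0 < d &
    forall w, (Re w = 0 \/ Im w = 0) -> modulus w < d -> A w.
Proof.
split=> [/nbhs_CxP[d d0 H]|[d d0 H]].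
  by exists d => // w wa wd; apply: H => //; rewrite subr0.
apply/nbhs_CxP; exists d => // w; rewrite subr0 => wd wa; exact: H.
Qed.

Lemma axes0_at0 (A : set C) : axes0 A -> A 0.
Proof. by move=> /axes0P[d d0]; apply; [left|rewrite modulus0]. Qed.

Lemma near0_small (e : R) : 0 < e -> \forall w \near axes0, modulus w < e.
Proof. by move=> e0; apply/axes0P; exists e. Qed.

Definition bounded_near r := exists M : R, \forall w \near axes0, modulus (r w) <= M.

Lemma bounded_cst z : bounded_near (fun=> z).
Proof. by exists (modulus z); near=> w. Unshelve. all: by end_near. Qed.

Lemma bounded_id : bounded_near id.
Proof.
exists 1; near=> w; apply/ltW; near: w; exact: near0_small.
Unshelve. all: by end_near. Qed.

Lemma boundedD r s : bounded_near r -> bounded_near s ->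
  bounded_near (fun w => r w + s w).
Proof.
move=> [M hM] [K hK]; exists (M + K); near=> w.
by rewrite (le_trans (modulusD _ _))// lerD//; near: w.
Unshelve. all: by end_near. Qed.

Lemma boundedN r : bounded_near r -> bounded_near (fun w => - r w).
Proof. by move=> [M hM]; exists M; near=> w; rewrite modulusN; near: w.
Unshelve. all: by end_near. Qed.

Lemma boundedM r s : bounded_near r -> bounded_near s ->
  bounded_near (fun w => r w * s w).
Proof.
move=> [M hM] [K hK]; exists (M * K); near=> w.
by rewrite modulusM ler_pM ?modulus_ge0//; near: w.
Unshelve. all: by end_near. Qed.

(** The expansion to second order of a function holomorphic near 0; the
    remainder is kept as w^3 times a bounded function so that the closure
    properties are polynomial identities. *)
Definition jet f := exists (a b c : C) r, bounded_near r /\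
  \forall w \near axes0, f w = a + b * w + c * w ^+ 2 + w ^+ 3 * r w.

Lemma jet_cst z : jet (fun=> z).
Proof.
exists z, 0, 0, (fun=> 0); split; first exact: bounded_cst.
by near=> w; rewrite !mul0r mulr0 !addr0.
Unshelve. all: by end_near. Qed.

Lemma jetD f g : jet f -> jet g -> jet (fun w => f w + g w).
Proof.
move=> [a [b [c [r [br hf]]]]] [a' [b' [c' [r' [br' hg]]]]].
exists (a + a'), (b + b'), (c + c'), (fun w => r w + r' w).
split; first exact: boundedD.
near=> w.
rewrite (near hf w _)// (near hg w _)//; ring.
Unshelve. all: by end_near. Qed.

Lemma jetM f g : jet f -> jet g -> jet (fun w => f w * g w).
Proof.
move=> [a [b [c [r [br hf]]]]] [a' [b' [c' [r' [br' hg]]]]].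
exists (a * a'), (a * b' + b * a'), (a * c' + b * b' + c * a'),
  (fun w => (b * c' + c * b') + w * (c * c') + (a + b * w + c * (w * w)) * r' w
            + r w * (a' + b' * w + c' * (w * w)) + (w * w * w) * (r w * r' w)).
split.
  by do ?[apply: boundedD|apply: boundedM|exact: bounded_cst
         |exact: bounded_id|done].
near=> w.
rewrite (near hf w _)// (near hg w _)//; ring.
Unshelve. all: by end_near. Qed.

Lemma jetX f k : jet f -> jet (fun w => f w ^+ k).
Proof.
move=> jf; elim: k => [|k IH].
  by under eq_fun do rewrite expr0; exact: jet_cst.
by under eq_fun do rewrite exprS; exact: jetM.
Qed.

Lemma jet_sum (I : Type) (s : seq I) (F : I -> C -> C) :
  (forall i, jet (F i)) -> jet (fun w => \sum_(i <- s) F i w).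
Proof.
move=> jF; elim: s => [|i s IH].
  by under eq_fun do rewrite big_nil; exact: jet_cst.
by under eq_fun do rewrite big_cons; exact: jetD.
Qed.

Lemma jet_prod (I : Type) (s : seq I) (F : I -> C -> C) :
  (forall i, jet (F i)) -> jet (fun w => \prod_(i <- s) F i w).
Proof.
move=> jF; elim: s => [|i s IH].
  by under eq_fun do rewrite big_nil; exact: jet_cst.
by under eq_fun do rewrite big_cons; exact: jetM.
Qed.

Lemma jet_near f (e : R) : jet f -> 0 < e ->
  \forall w \near axes0, modulus (f w - f 0) < e.
Proof.
move=> [a [b [c [r [br hf]]]]] e0.
have f0 : f 0 = a by rewrite (axes0_at0 _ hf); ring.
have [M hM] : bounded_near (fun w => b + c * w + w * w * r w).
  by do ?[apply: boundedD|apply: boundedM|exact: bounded_cst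
         |exact: bounded_id|done].
near=> w.
have -> : f w - f 0 = w * (b + c * w + w * w * r w).
  by rewrite f0 (near hf w _)//; ring.
have M1 : 0 < `|M| + 1 by rewrite ltr_wpDl.
rewrite modulusM (@le_lt_trans _ _ (modulus w * (`|M| + 1)))//.
  rewrite ler_wpM2l ?modulus_ge0// (@le_trans _ _ M)//; first by near: w.
  by rewrite (le_trans (ler_norm _))// lerDl.
rewrite -ltr_pdivlMr//; near: w; apply: near0_small; exact: divr_gt0.
Unshelve. all: by end_near. Qed.

Lemma jet_neq0 f : jet f -> f 0 != 0 -> \forall w \near axes0, f w != 0.
Proof.
move=> jf f0; near=> w; apply/eqP => fw.
have : modulus (f w - f 0) < modulus (f 0).
  by near: w; apply: jet_near; rewrite ?modulus_gt0.
by rewrite fw sub0r modulusN ltxx.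
Unshelve. all: by end_near. Qed.

(** The quadratic polynomial with coefficients a^-1, p, q below is the inverse
    of a + b w + c w^2 modulo w^3. *)
Lemma jetV f : jet f -> f 0 != 0 -> jet (fun w => (f w)^-1).
Proof.
move=> jf f0; have nz := jet_neq0 _ jf f0.
have bV : bounded_near (fun w => (f w)^-1).
  exists (modulus (f 0) / 2)^-1; near=> w.
  rewrite modulusV lef_pV2 ?posrE ?divr_gt0 ?modulus_gt0//; last by near: w.
  have : modulus (f w - f 0) < modulus (f 0) / 2.
    by near: w; apply: jet_near; rewrite ?divr_gt0 ?modulus_gt0.
  have : modulus (f 0) <= modulus (f w) + modulus (f w - f 0).
    rewrite -(modulusN (f w - f 0)) (le_trans _ (modulusD _ _))//.
    by rewrite opprB addrC subrK.
  lra.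
move: jf => [a [b [c [r [br hf]]]]].
have fa : f 0 = a by rewrite (axes0_at0 _ hf); ring.
have a0 : a != 0 by rewrite -fa.
pose p := - a^-2 * b; pose q := b ^+ 2 * a^-3 - a^-2 * c.
exists a^-1, p, q,
  (fun w => - ((p * c + q * b) + q * c * w + (a^-1 + p * w + q * (w * w)) * r w)
            * (f w)^-1).
split.
  by do ?[apply: boundedD|apply: boundedM|apply: boundedN|exact: bounded_cst
         |exact: bounded_id|done].
near=> w.
have fw : f w != 0 by near: w.
apply: (mulIf fw); rewrite mulVf//.
rewrite mulrDl -!mulrA mulVf// mulr1.
rewrite (near hf w _)// /p /q.
by field.
Unshelve. all: by end_near. Qed.

Lemma eq_jet f g : (\forall w \near axes0, f w = g w) -> jet f -> jet g.
Proof.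
move=> fg [a [b [c [r [br hf]]]]]; exists a, b, c, r; split=> //.
by near=> w; rewrite -(near fg w _)// (near hf w _).
Unshelve. all: by end_near. Qed.

End Jets.

Section ExponentialJet.
Context {R : realType}.
Local Notation C := (Cx R).

(** Iterating this bound gives the Taylor expansions of sin, cos and exp. *)
Lemma bound_by_derivative (f f' : R -> R) (M : R) (k : nat) :
  (forall t, is_derive t (1 : R) f (f' t)) -> f 0 = 0 ->
  (forall t, `|t| <= 1 -> `|f' t| <= M * `|t| ^+ k) ->
  forall t, `|t| <= 1 -> `|f t| <= M * `|t| ^+ k.+1.
Proof.
move=> df f0 bf'.
have cf (A : set R) : {within A, continuous f}.
  apply/continuous_subspaceT => x; apply/differentiable_continuous.
  by apply/derivable1_diffP; have [] := df x.
suff H a b : a <= b -> (a = 0 \/ b = 0) -> `|a| <= 1 -> `|b| <= 1 ->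
    `|f b - f a| <= M * (`|a| + `|b|) ^+ k * (b - a).
  move=> t t1; have [t0|t0] := leP 0 t.
    have := H 0 t t0 (or_introl erefl) _ t1.
    rewrite f0 !subr0 normr0 add0r exprSr mulrA (ger0_norm t0); exact.
  have := H t 0 (ltW t0) (or_intror erefl) t1 _.
  by rewrite f0 !sub0r normrN normr0 addr0 exprSr mulrA (ltr0_norm t0); apply.
move=> ab a0b0 a1 b1.
have [c cab ->] := MVT_segment ab (fun x _ => df x) (cf _).
rewrite normrM (ger0_norm (_ : 0 <= b - a)) ?subr_ge0//.
apply: ler_wpM2r; first by rewrite subr_ge0.
have M0 : 0 <= M.
  by have := bf' 1; rewrite normr1 expr1n mulr1 => /(_ (lexx _)); apply: le_trans.
have cl : `|c| <= `|a| + `|b|.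
  move: cab; rewrite in_itv/= => /andP[ac cb].
  case: a0b0 => ?; subst; rewrite normr0 ?add0r ?addr0.
    by rewrite !ger0_norm// (le_trans ac cb).
  by rewrite !ler0_norm ?lerN2// (le_trans ac cb).
have c1 : `|c| <= 1.
  by rewrite (le_trans cl)//; case: a0b0 => ?; subst; rewrite normr0 ?add0r ?addr0.
apply: (le_trans (bf' _ c1)); apply: ler_wpM2l => //.
by apply: lerXn2r; rewrite ?nnegrE.
Qed.

Lemma sin_taylor0 (t : R) : `|t| <= 1 -> `|sin t| <= `|t| ^+ 1.
Proof.
rewrite -[`|t| ^+ 1]mul1r; move: t.
have D t : is_derive t (1 : R) sin (cos t) by exact: is_derive_sin.
apply: (bound_by_derivative _ _ _ _ D) => [|t _]; first exact: sin0.
by rewrite expr0 mulr1 ler_norml cos_geN1 cos_le1.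
Qed.

Lemma cos_taylor0 (t : R) : `|t| <= 1 -> `|cos t - 1| <= `|t| ^+ 2.
Proof.
rewrite -[`|t| ^+ 2]mul1r; move: t.
have D t : is_derive t (1 : R) (fun t : R => cos t - 1) (- sin t).
  by apply: is_derive_eq; ring.
apply: (bound_by_derivative _ _ _ _ D) => [|t t1]; first by rewrite cos0 subrr.
by rewrite normrN mul1r; exact: sin_taylor0.
Qed.

Lemma sin_taylor2 (t : R) : `|t| <= 1 -> `|sin t - t| <= `|t| ^+ 3.
Proof.
rewrite -[`|t| ^+ 3]mul1r; move: t.
have D t : is_derive t (1 : R) (fun t : R => sin t - t) (cos t - 1).
  by apply: is_derive_eq; ring.
apply: (bound_by_derivative _ _ _ _ D) => [|t t1]; first by rewrite sin0 subrr.
by rewrite mul1r; exact: cos_taylor0.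
Qed.

Lemma cos_taylor2 (t : R) : `|t| <= 1 -> `|cos t - 1 + t ^+ 2 / 2| <= `|t| ^+ 3.
Proof.
move=> t1; apply: (@le_trans _ _ (`|t| ^+ 4)); last first.
  by rewrite exprSr ler_piMr ?exprn_ge0.
rewrite -[`|t| ^+ 4]mul1r; move: t t1.
have D t : is_derive t (1 : R) (fun t : R => cos t - 1 + t ^+ 2 / 2) (- (sin t - t)).
  by apply: is_derive_eq; rewrite /GRing.scale /=; field.
apply: (bound_by_derivative _ _ _ _ D) => [|t t1]; first by rewrite cos0; ring.
by rewrite mul1r normrN; exact: sin_taylor2.
Qed.

Lemma expR_taylor2 : forall t : R, `|t| <= 1 ->
  `|expR t - 1 - t - t ^+ 2 / 2| <= expR 1 * `|t| ^+ 3.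
Proof.
have D0 t : is_derive t (1 : R) (fun t : R => expR t - 1) (expR t).
  by apply: is_derive_eq; ring.
have D1 t : is_derive t (1 : R) (fun t : R => expR t - 1 - t) (expR t - 1).
  by apply: is_derive_eq; ring.
have D2 t : is_derive t (1 : R) (fun t : R => expR t - 1 - t - t ^+ 2 / 2)
    (expR t - 1 - t).
  by apply: is_derive_eq; rewrite /GRing.scale /=; field.
apply: (bound_by_derivative _ _ _ _ D2); first by rewrite expR0; ring.
apply: (bound_by_derivative _ _ _ _ D1); first by rewrite expR0; ring.
apply: (bound_by_derivative _ _ _ _ D0); first by rewrite expR0; ring.
move=> t t1; rewrite expr0 mulr1 ger0_norm ?expR_ge0// ler_expR.
exact: le_trans (ler_norm _) t1.
Qed.

Lemma jet_cexp (x : R) : jet (fun w : C => cexp ('i%C * (x%:C%C * w))).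
Proof.
pose l : C := 'i%C * x%:C%C.
pose p (w : C) := 1 + l * w + l ^+ 2 / 2 * w ^+ 2.
exists 1, l, (l ^+ 2 / 2), (fun w => (cexp ('i%C * (x%:C%C * w)) - p w) / w ^+ 3).
pose M := (2 + expR 1) * `|x| ^+ 3.
have M0 : 0 <= M by rewrite mulr_ge0 ?exprn_ge0// addr_ge0 ?expR_ge0.
suff hM : \forall w \near axes0,
    modulus (cexp ('i%C * (x%:C%C * w)) - p w) <= M * modulus w ^+ 3.
  split; last first.
    near=> w; have [->|w0] := eqVneq w 0.
      by rewrite !mulr0 !expr0n/= mulr0 mul0r !addr0 /cexp /= expR0 cos0 sin0 mul1r.
    by rewrite [w ^+ 3 * _]mulrC divfK ?expf_neq0// /p; ring.
  exists M; near=> w; have [->|w0] := eqVneq w 0.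
    by rewrite exprS mul0r invr0 mulr0 modulus0.
  rewrite modulusM modulusV modulusX ler_pdivrMr ?exprn_gt0 ?modulus_gt0//.
  by near: w.
apply/axes0P; exists (`|x| + 1)^-1; first by rewrite invr_gt0 ltr_wpDl.
move=> [a b] ab wd; have {}ab : a = 0 \/ b = 0 by exact: ab.
have xw1 c : `|c| <= modulus ((a +i* b)%C : C) -> `|x * c| <= 1.
  move=> cw; rewrite normrM (@le_trans _ _ ((`|x| + 1) * modulus ((a +i* b)%C : C)))//.
    by rewrite ler_pM// lerDl.
  by rewrite mulrC -ler_pdivlMr ?ltr_wpDl// div1r ltW.
case: ab => ?; subst.
  have xb := xw1 b (modulus_Im (0 +i* b)%C).
  have := @expR_taylor2 (- (x * b)); rewrite normrN => /(_ xb).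
  have -> : modulus ((0 +i* b)%C : C) = `|b|.
    by rewrite /modulus /= expr0n/= add0r sqrtr_sqr.
  rewrite normrM => H.
  have -> : cexp ('i%C * (x%:C%C * (0 +i* b)%C)) - p (0 +i* b)%C =
    ((expR (- (x * b)) - 1 - (- (x * b)) - (- (x * b)) ^+ 2 / 2)%:C)%C.
    have lw : l * (0 +i* b)%C = ((- (x * b))%:C)%C.
      by apply/eqP; rewrite eq_complex /=; apply/andP; split; apply/eqP; ring.
    have -> : p (0 +i* b)%C = 1 + l * (0 +i* b)%C + (l * (0 +i* b)%C) ^+ 2 / 2.
      by rewrite /p; ring.
    rewrite mulrA -/l lw; apply/eqP; rewrite /cexp eq_complex /= sin0 cos0.
    by apply/andP; split; apply/eqP; field.
  rewrite modulus_real (le_trans H)// exprMn /M mulrA ler_wpM2r ?exprn_ge0//.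
  by rewrite ler_wpM2r ?exprn_ge0// lerDr.
have xb := xw1 a (modulus_Re (a +i* 0)%C).
have -> : modulus ((a +i* 0)%C : C) = `|a|.
  by rewrite /modulus /= expr0n/= addr0 sqrtr_sqr.
have -> : cexp ('i%C * (x%:C%C * (a +i* 0)%C)) - p (a +i* 0)%C =
   ((cos (x * a) - 1 + (x * a) ^+ 2 / 2)%:C)%C
   + 'i%C * ((sin (x * a) - (x * a))%:C)%C.
  have lw : l * (a +i* 0)%C = (0 +i* (x * a))%C.
    by apply/eqP; rewrite eq_complex /=; apply/andP; split; apply/eqP; ring.
  have -> : p (a +i* 0)%C = 1 + l * (a +i* 0)%C + (l * (a +i* 0)%C) ^+ 2 / 2.
    by rewrite /p; ring.
  rewrite mulrA -/l lw; apply/eqP; rewrite /cexp eq_complex /= expR0.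
  by apply/andP; split; apply/eqP; field.
have i1 : modulus ('i%C : C) = 1.
  by rewrite /modulus/= expr0n/= add0r expr1n sqrtr1.
rewrite (le_trans (modulusD _ _))// modulusM i1 mul1r !modulus_real.
have := sin_taylor2 _ xb; have := cos_taylor2 _ xb; rewrite normrM => H1 H2.
rewrite (le_trans (lerD H1 H2))//.
rewrite -mulr2n -mulr_natl exprMn mulrA ler_wpM2r ?exprn_ge0//.
by rewrite /M ler_wpM2r ?exprn_ge0// lerDl expR_ge0.
Unshelve. all: by end_near.
Qed.

End ExponentialJet.

(** * Strict differentiability of functions of several complex variables *)

Section Differential.
Context {R : realType} {N : nat}.
Local Notation C := (Cx R).
Local Notation V := 'rV[C]_N.
Implicit Types (u : V -> R) (v z p h : V) (Om : set V).

Lemma nbhs_rVP z (A : set V) :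
  nbhs z A <-> exists2 d : R, 0 < d &
    forall y : V, (forall j, modulus (y 0 j - z 0 j) < d) -> A y.
Proof.
split.
  move=> [P zP sPA].
  have : forall j, exists d : R, 0 < d /\
      forall w, modulus (w - z 0 j) < d -> P 0 j w.
    by move=> j; have /nbhs_CxP[d d0 H] := zP 0 j; exists d.
  move=> /boolp.choice[d hd].
  exists (\big[Num.min/1]_j d j).
    by elim/big_ind: _ => // [x y x0 y0|j _]; [rewrite lt_min x0|have [] := hd j].
  move=> y hy; apply: sPA => i j; rewrite ord1; have [_] := hd j; apply.
  by apply: (lt_le_trans (hy j)); exact: bigmin_le_cond.
move=> [d d0 H]; exists (fun _ j => [set w | modulus (w - z 0 j) < d]).
  by move=> i j; rewrite ord1; apply/nbhs_CxP; exists d.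
by move=> y hy; apply: H => j; exact: hy.
Qed.

Definition l1 h : R := \sum_j (`|Re (h 0 j)| + `|Im (h 0 j)|).

Definition unit_re (j : 'I_N) : V := delta_mx 0 j.
Definition unit_im (j : 'I_N) : V := 'i%C *: delta_mx 0 j.

(** A real linear form on C^N; A and B are its values on the vectors e_j and
    i e_j. *)
Definition real_linear (A B : 'I_N -> R) h : R :=
  \sum_j (Re (h 0 j) * A j + Im (h 0 j) * B j).

Lemma real_linearD A B h h' :
  real_linear A B (h + h') = real_linear A B h + real_linear A B h'.
Proof.
rewrite /real_linear -big_split /=; apply: eq_bigr => j _.
have -> : (h + h') 0 j = h 0 j + h' 0 j by rewrite mxE.
by rewrite ReD ImD !mulrDl addrACA.
Qed.

Lemma real_linear_bound A B :
  exists2 K : R, 0 <= K & forall h, `|real_linear A B h| <= K * l1 h.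
Proof.
exists (\sum_j (`|A j| + `|B j|)).
  by apply: sumr_ge0 => j _; rewrite addr_ge0.
move=> h; rewrite (le_trans (ler_norm_sum _ _ _))// /l1 mulr_sumr.
apply: ler_sum => j _; rewrite (le_trans (ler_normD _ _))// mulrDr !normrM.
have AB : `|A j| + `|B j| <= \sum_j (`|A j| + `|B j|).
  rewrite [leRHS](bigD1 j)//= lerDl sumr_ge0// => k _; exact: addr_ge0.
apply: lerD; rewrite mulrC ler_wpM2r// (le_trans _ AB)// ?lerDl ?lerDr//.
Qed.

Definition differential u z : V -> R :=
  real_linear (fun j => dir_deriv (unit_re j) u z)
              (fun j => dir_deriv (unit_im j) u z).

(** The directional derivatives are defined by derivatives at time 0 of lines
    based at every point; this moves them to any time on a single line. *)
Lemma is_derive_line u v z (t : R) :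
  derivable (fun s : R => u (z + (t%:C%C : C) *: v + (s%:C%C : C) *: v)) 0 1 ->
  is_derive t (1 : R) (fun s : R => u (z + (s%:C%C : C) *: v))
    (dir_deriv v u (z + (t%:C%C : C) *: v)).
Proof.
move=> dz.
have E : (fun h : R => h^-1 *: (u (z + ((h *: (1:R) + t)%:C%C : C) *: v)
             - u (z + (t%:C%C : C) *: v)))
   = (fun h : R => h^-1 *: (u (z + (t%:C%C : C) *: v + ((h *: (1:R) + 0)%:C%C : C) *: v)
             - u (z + (t%:C%C : C) *: v + ((0:R)%:C%C : C) *: v))).
  have E1 (h : R) : z + ((h *: (1:R) + t)%:C%C : C) *: v =
      z + (t%:C%C : C) *: v + ((h *: (1:R) + 0)%:C%C : C) *: v.
    by rewrite (addrC _ t) addr0 realCD scalerDl addrA.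
  have E0 : z + (t%:C%C : C) *: v = z + (t%:C%C : C) *: v + ((0:R)%:C%C : C) *: v.
    by rewrite -[LHS]addr0; congr (_ + _); exact/esym/scale0r.
  by apply/funext => h; rewrite -E1 -E0.
apply: DeriveDef; first by rewrite /derivable E; exact: dz.
rewrite /derive E /dir_deriv derive1E; exact: erefl.
Qed.

End Differential.

Section StrictDifferentiability.
Context {R : realType} {N : nat}.
Local Notation C := (Cx R).
Local Notation V := 'rV[C]_N.
Implicit Types (u : V -> R) (v z p h : V) (Om : set V).

Lemma mean_value_line u v p (t m K : R) :
  (forall s : R, `|s| <= `|t| ->
    derivable (fun x : R => u (p + (s%:C%C : C) *: v + (x%:C%C : C) *: v)) 0 1) ->
  (forall s : R, `|s| <= `|t| -> `|dir_deriv v u (p + (s%:C%C : C) *: v) - m| <= K) ->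
  `|u (p + (t%:C%C : C) *: v) - u p - t * m| <= K * `|t|.
Proof.
move=> du bu.
pose f (s : R) := u (p + (s%:C%C : C) *: v) - s * m.
pose f' (s : R) := dir_deriv v u (p + (s%:C%C : C) *: v) - m.
have df (s : R) : `|s| <= `|t| -> is_derive s (1 : R) f (f' s).
  move=> st; have := is_derive_line u v p s (du s st).
  move=> D; apply: is_derive_eq; rewrite /f' /GRing.scale /=; ring.
have cf a b : (forall s, s \in `[a, b] -> `|s| <= `|t|) -> {within `[a, b], continuous f}.
  move=> H; apply: derivable_within_continuous => s /H /df []; by [].
have f0 : f 0 = u p.
  rewrite /f mul0r subr0; congr u; rewrite -[RHS]addr0; congr (_ + _).
  exact: scale0r.
have -> : u (p + (t%:C%C : C) *: v) - u p - t * m = f t - f 0.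
  by rewrite f0 /f; ring.
have [t0|t0] := leP 0 t.
  have sub s : s \in `[0, t] -> `|s| <= `|t|.
    by rewrite in_itv/= => /andP[s0 st]; rewrite !ger0_norm.
  have [c cab ->] := MVT_segment t0 (fun x hx => df x (sub x (subset_itv_oo_cc hx))) (cf _ _ sub).
  rewrite subr0 normrM ler_wpM2r//; apply: bu; exact: sub.
have sub s : s \in `[t, 0] -> `|s| <= `|t|.
  by rewrite in_itv/= => /andP[s0 st]; rewrite !ler0_norm ?lerN2// ltW.
have [c cab E] := MVT_segment (ltW t0) (fun x hx => df x (sub x (subset_itv_oo_cc hx))) (cf _ _ sub).
rewrite -normrN opprB E sub0r normrM normrN ler_wpM2r//; apply: bu; exact: sub.
Qed.

Lemma modulus_unit_re (j i : 'I_N) : modulus (unit_re j 0 i : C) <= 1.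
Proof.
rewrite mxE; case: (_ && _); first by rewrite mulr1n modulus1.
by rewrite mulr0n modulus0 ler01.
Qed.

Lemma modulus_unit_im (j i : 'I_N) : modulus (unit_im j 0 i : C) <= 1.
Proof.
rewrite [unit_im j 0 i]mxE modulusM -[leRHS]mul1r ler_pM ?modulus_ge0//.
  by rewrite /modulus/= expr0n/= add0r expr1n sqrtr1.
exact: modulus_unit_re.
Qed.

Lemma move_along_line z p v (r t : R) :
  (forall j, modulus (p 0 j - z 0 j) < r) -> (forall j, modulus (v 0 j) <= 1) ->
  forall j, modulus ((p + (t%:C%C : C) *: v) 0 j - z 0 j) < r + `|t|.
Proof.
move=> pr v1 j.
have -> : (p + (t%:C%C : C) *: v) 0 j = p 0 j + (t%:C%C : C) * v 0 j by rewrite !mxE.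
rewrite addrAC (le_lt_trans (modulusD _ _))// ltr_leD// modulusM modulus_real.
by rewrite -[leRHS]mulr1 ler_wpM2l.
Qed.

Lemma sum_units h : \sum_j (((Re (h 0 j))%:C%C : C) *: unit_re j
    + ((Im (h 0 j))%:C%C : C) *: unit_im j) = h.
Proof.
rewrite [RHS]row_sum_delta; apply: eq_bigr => j _.
rewrite scalerA -scalerDl; congr (_ *: _).
by case: (h 0 j) => a b; apply/eqP; rewrite eq_complex /=; apply/andP; split;
   apply/eqP; ring.
Qed.

Lemma add_three_increments (x0 x1 x2 x3 a b c a' b' c' k : R) :
  `|x1 - x0 - a| <= k * a' -> `|x2 - x1 - b| <= k * b' ->
  `|x3 - x2 - c| <= k * c' -> `|x3 - x0 - (a + b + c)| <= k * (a' + b' + c').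
Proof.
move=> H1 H2 H3.
have -> : x3 - x0 - (a + b + c) = (x1 - x0 - a) + (x2 - x1 - b) + (x3 - x2 - c).
  by ring.
rewrite (le_trans (ler_normD _ _))// !mulrDr lerD//.
by rewrite (le_trans (ler_normD _ _))// lerD.
Qed.

(** The increment from p to p + h is split into 2N moves along the vectors e_j
    and i e_j, each controlled by one partial derivative; r bounds the distance
    to z of the point reached so far. *)
Lemma telescope_increment u z (A B : 'I_N -> R) (d k : R) :
  (forall j (q : V) (r t : R), (forall i, modulus (q 0 i - z 0 i) < r) ->
    r + `|t| <= d -> `|u (q + (t%:C%C : C) *: unit_re j) - u q - t * A j| <= k * `|t|) ->
  (forall j (q : V) (r t : R), (forall i, modulus (q 0 i - z 0 i) < r) ->
    r + `|t| <= d -> `|u (q + (t%:C%C : C) *: unit_im j) - u q - t * B j| <= k * `|t|) ->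
  forall p h (r : R), (forall j, modulus (p 0 j - z 0 j) < r) -> r + l1 h <= d ->
    `|u (p + h) - u p - real_linear A B h| <= k * l1 h.
Proof.
move=> stepA stepB p h; rewrite -[in u (p + h)](sum_units h) /l1 /real_linear.
elim: (index_enum 'I_N) p => [|i s IH] p r pr rd.
  by rewrite !big_nil addr0 subr0 subrr normr0 mulr0.
rewrite !big_cons.
pose p1 := p + ((Re (h 0 i))%:C%C : C) *: unit_re i.
pose p2 := p1 + ((Im (h 0 i))%:C%C : C) *: unit_im i.
rewrite big_cons in rd.
have S0 : 0 <= \sum_(j <- s) (`|Re (h 0 j)| + `|Im (h 0 j)|).
  by apply: sumr_ge0 => j _; exact: addr_ge0.
have p1r := move_along_line z p _ r (Re (h 0 i)) pr (modulus_unit_re i).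
have p2r := move_along_line z p1 _ _ (Im (h 0 i)) p1r (modulus_unit_im i).
move: (Re (h 0 i)) (Im (h 0 i)) @p1 @p2 p1r p2r rd => a b p1 p2 p1r p2r rd.
have H1 : `|u p1 - u p - a * A i| <= k * `|a|.
  by apply: (stepA _ _ _ _ pr); have := normr_ge0 b; lra.
have H2 : `|u p2 - u p1 - b * B i| <= k * `|b|.
  by apply: (stepB _ _ _ _ p1r); lra.
set hs := \sum_(j <- s) _.
set S := \sum_(j <- s) (`|_| + `|_|) in rd S0 *.
set T := \sum_(j <- s) (_ * _ + _ * _).
have rdS : r + `|a| + `|b| + S <= d by lra.
have H3 : `|u (p2 + hs) - u p2 - T| <= k * S by exact: IH p2 _ p2r rdS.
have -> : p + ((a%:C%C : C) *: unit_re i + (b%:C%C : C) *: unit_im i + hs) = p2 + hs.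
  by rewrite /p2 /p1 !addrA.
exact: (add_three_increments _ _ _ _ _ _ _ _ _ _ _ H1 H2 H3).
Qed.

(** The base point p may vary near z: this is what allows to replace, in
    [spsh_submean], the points of a curve by points of its tangent line, to
    which the derivatives in a fixed direction apply. *)
Lemma Ck_strict_differential Om u z (k : R) : open Om -> Ck 1 Om u -> Om z ->
  0 < k -> exists2 d : R, 0 < d & forall p h,
    (forall j, modulus (p 0 j - z 0 j) < d) -> l1 h < d ->
    `|u (p + h) - u p - differential u z h| <= k * l1 h.
Proof.
move=> oOm [_ Cu] Oz k0.
pose close v y := Om y /\ `|dir_deriv v u y - dir_deriv v u z| <= k.
have near_close v : \forall y \near z, close v y.
  apply: filterI; first exact: open_nbhs_nbhs.
  have [_ [cv _]] := Cu v.
  have /cvgrPdist_le /(_ k k0) := cv z Oz.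
  by apply: filterS => y; rewrite distrC.
have all_close : \forall y \near z, forall j : 'I_N,
    close (unit_re j) y /\ close (unit_im j) y.
  apply: (@filter_forall V 'I_N
    (fun j y => close (unit_re j) y /\ close (unit_im j) y) (nbhs z) _) => j.
  by apply: filterI; exact: near_close.
have /nbhs_rVP[d d0 hd] := all_close.
have step v p (r t : R) : (forall j, modulus (p 0 j - z 0 j) < r) ->
    r + `|t| <= d -> (forall j, modulus (v 0 j) <= 1) ->
    (forall y : V, (forall j, modulus (y 0 j - z 0 j) < d) -> close v y) ->
    `|u (p + (t%:C%C : C) *: v) - u p - t * dir_deriv v u z| <= k * `|t|.
  move=> pr rd v1 cv.
  have cvs (s : R) : `|s| <= `|t| -> close v (p + (s%:C%C : C) *: v).
    move=> st; apply: cv => j; apply: (lt_le_trans (move_along_line z p v r s pr v1 j)).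
    by apply: le_trans rd; rewrite lerD2l.
  apply: mean_value_line => s /cvs[Os ds]; last exact: ds.
  by have [+ _] := Cu v; move=> /(_ _ Os).
exists (d / 2); first exact: divr_gt0.
move=> p h pd hd2.
apply: (telescope_increment u z _ _ d k _ _ p h _ pd).
- move=> j q r t qr rd.
  exact: step (unit_re j) q r t qr rd (modulus_unit_re j) (fun y yd => (hd y yd j).1).
- move=> j q r t qr rd.
  exact: step (unit_im j) q r t qr rd (modulus_unit_im j) (fun y yd => (hd y yd j).2).
- by move: hd2; lra.
Qed.

End StrictDifferentiability.

(** * Plurisubharmonic functions along holomorphic curves *)

Section SecondDifference.
Context {R : realType}.
Local Notation C := (Cx R).

(** The function f(t) + f(-t) - (D - k) t^2 has derivative
    g(t) - g(-t) - 2 (D - k) t, nonnegative for small t > 0 since the first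
    difference is 2 D t + o(t). *)
Lemma symmetric_second_difference (f g : R -> R) (D k d : R) : 0 < d ->
  (forall t : R, `|t| < d -> is_derive t (1 : R) f (g t)) ->
  is_derive (0 : R) (1 : R) g D -> 0 < k ->
  \forall e \near (0 : R)^'+, (D - k) * e ^+ 2 <= f e + f (- e) - 2 * f 0.
Proof.
move=> d0 df [dg gD] k0.
have : (fun h : R => h^-1 *: (g (h *: (1 : R) + 0) - g 0)) @ 0^' --> D by rewrite -gD.
move=> /cvgrPdist_le/(_ (k / 2)) /(_ (divr_gt0 k0 (ltr0Sn _ _))).
rewrite near_withinE => /nbhs_ballP[d' /= d'0 hd'].
have slope (t : R) : t != 0 -> `|t| < d' -> `|D - t^-1 * (g t - g 0)| <= k / 2.
  move=> t0 td; have := hd' t; rewrite /ball /= sub0r normrN => /(_ td t0).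
  by rewrite /GRing.scale /= mulr1 addr0.
near=> e.
have e0 : 0 < e by [].
have ed : e < d by near: e; exact: nbhs_right_lt.
have ed' : e < d' by near: e; exact: nbhs_right_lt.
pose F (t : R) := f t + f (- t) - (D - k) * t ^+ 2.
pose G (t : R) := g t - g (- t) - (D - k) * (2 * t).
have dF (t : R) : `|t| < d -> is_derive t (1 : R) F (G t).
  move=> td; have D1 := df t td.
  have D2 : is_derive (- t : R) (1 : R) f (g (- t)) by apply: df; rewrite normrN.
  have D0 : is_derive t (1 : R) (fun x : R => - x) (- 1) by apply: is_derive_eq.
  have D3 : is_derive t (1 : R) (fun x : R => f (- x)) (g (- t) * - 1).
    exact: (@is_derive1_comp R f (fun x : R => - x) t _ _ D2 D0).
  apply: is_derive_eq; rewrite /G /GRing.scale /=; ring.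
have cF : {within `[0, e], continuous F}.
  apply: derivable_within_continuous => s; rewrite in_itv /= => /andP[s0 se].
  by have [] := dF s; rewrite // ger0_norm// (le_lt_trans se).
have sub x : x \in `]0, e[ -> `|x| < d.
  by rewrite in_itv/= => /andP[x0 xe]; rewrite ger0_norm ?ltW// (lt_trans xe).
have [c cab E] := MVT_segment (ltW e0) (fun x hx => dF x (sub x hx)) cF.
have {}E : 0 <= F e - F 0.
  rewrite E subr0 mulr_ge0 ?(ltW e0)//.
  move: cab; rewrite in_itv/= => /andP[c0 ce].
  have [->|c1] := eqVneq c 0; first by rewrite /G oppr0 subrr !mulr0 subr0 lexx.
  have {c1}c0 : 0 < c by rewrite lt_def c1.
  have cd : c < d' by exact: le_lt_trans ed'.
  have := slope c; rewrite gt_eqF// gtr0_norm// => /(_ isT cd).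
  have := slope (- c); rewrite oppr_eq0 gt_eqF// normrN gtr0_norm// => /(_ isT cd).
  rewrite !ler_norml => /andP[_ h1] /andP[_ h2].
  have : D - k / 2 <= c^-1 * (g c - g 0) by lra.
  rewrite ler_pdivlMl// => h3.
  have : D - k / 2 <= c^-1 * (g 0 - g (- c)).
    by move: h1; rewrite invrN mulNr -mulrN opprB; lra.
  rewrite ler_pdivlMl// => h4.
  by rewrite /G; nra.
move: E; rewrite /F oppr0 expr0n/=; lra.
Unshelve. all: by end_near. 
Qed.

End SecondDifference.

Section FourPoints.
Context {R : realType} {N : nat}.
Local Notation C := (Cx R).
Local Notation V := 'rV[C]_N.
Implicit Types (u : V -> R) (v z p h : V) (Om : set V).

Lemma line_stays_in Om z v : open Om -> Om z ->
  exists2 d : R, 0 < d & forall t : R, `|t| < d -> Om (z + (t%:C%C : C) *: v).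
Proof.
move=> oOm Oz; have : nbhs z Om by exact: open_nbhs_nbhs.
move=> /nbhs_rVP[d d0 hd]; pose K : R := \sum_j modulus (v 0 j).
have K0 : 0 <= K by apply: sumr_ge0 => j _; exact: modulus_ge0.
exists (d / (K + 1)); first by rewrite divr_gt0// ltr_wpDl.
move=> t; rewrite ltr_pdivlMr ?ltr_wpDl// => td; apply: hd => j.
have -> : (z + (t%:C%C : C) *: v) 0 j - z 0 j = (t%:C%C : C) * v 0 j.
  by rewrite !mxE addrAC subrr add0r.
rewrite modulusM modulus_real (le_lt_trans _ td)// ler_wpM2l//.
rewrite (@le_trans _ _ K) ?lerDl// /K (bigD1 j)//= lerDl.
by apply: sumr_ge0 => i _; exact: modulus_ge0.
Qed.

Lemma line_second_difference Om u z v (k : R) :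
  open Om -> Ck 2 Om u -> Om z -> 0 < k ->
  \forall e \near (0 : R)^'+, (dir_deriv v (dir_deriv v u) z - k) * e ^+ 2 <=
    u (z + (e%:C%C : C) *: v) + u (z + ((- e)%:C%C : C) *: v) - 2 * u z.
Proof.
move=> oOm [_ C2u] Oz k0.
have z0 : z + ((0 : R)%:C%C : C) *: v = z.
  by rewrite -[RHS]addr0; congr (_ + _); exact: scale0r.
have [du [_ /(_ v)[ddu _]]] := C2u v.
have [d d0 hd] := line_stays_in Om z v oOm Oz.
have D1 t (td : `|t| < d) := is_derive_line u v z t (du _ (hd t td)).
have D2 : is_derive (0 : R) (1 : R) (fun s : R => dir_deriv v u (z + (s%:C%C : C) *: v))
    (dir_deriv v (dir_deriv v u) z).
  have := is_derive_line (dir_deriv v u) v z 0; rewrite z0; apply; exact: ddu.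
have := symmetric_second_difference _ _ _ k d d0 D1 D2 k0.
by rewrite z0.
Qed.

(** Four points suffice to detect the Laplacian: the sums of their first,
    second and third powers vanish. *)
Definition sum4 (f : C -> R) (e : R) : R :=
  f (e%:C)%C + f ((- e)%:C)%C + f ('i * e%:C)%C + f ('i * (- e)%:C)%C.

Lemma near_four_points (A : set C) : axes0 A -> \forall e \near (0 : R)^'+,
  [/\ A (e%:C)%C, A ((- e)%:C)%C, A ('i * e%:C)%C & A ('i * (- e)%:C)%C].
Proof.
move=> /axes0P[d d0 H]; near=> e.
have e0 : 0 < e by [].
have ed : e < d by near: e; exact: nbhs_right_lt.
have i1 : modulus ('i%C : C) = 1.
  by rewrite /modulus/= expr0n/= add0r expr1n sqrtr1.
split; apply: H; rewrite ?modulusM ?i1 ?mul1r ?modulus_real ?normrN ?gtr0_norm//.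
- by right.
- by right.
- by left; rewrite /= mul0r mulr0 subr0.
- by left; rewrite /= mul0r mulr0 subr0.
Unshelve. all: by end_near.
Qed.

End FourPoints.

Section SubmeanCurve.
Context {R : realType} {N : nat}.
Local Notation C := (Cx R).
Local Notation V := 'rV[C]_N.
Implicit Types (u : V -> R) (v z p h : V) (Om : set V).

Lemma l1_ge0 h : 0 <= l1 h.
Proof. by apply: sumr_ge0 => j _; exact: addr_ge0. Qed.

Lemma l1D h h' : l1 (h + h') <= l1 h + l1 h'.
Proof.
rewrite /l1 -big_split /=; apply: ler_sum => j _.
have -> : (h + h') 0 j = h 0 j + h' 0 j by rewrite mxE.
by rewrite ReD ImD addrACA lerD// ler_normD.
Qed.

Lemma modulus_le_l1 (w : C) : modulus w <= `|Re w| + `|Im w|.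
Proof.
case: w => a b; rewrite /modulus /=.
rewrite -[leRHS]ger0_norm ?addr_ge0// -sqrtr_sqr ler_wsqrtr//.
rewrite sqrrD !real_normK ?num_real// addrAC lerDl.
by rewrite mulrn_wge0// mulr_ge0.
Qed.

Lemma l1Z (w : C) h : l1 (w *: h) <= 2 * modulus w * l1 h.
Proof.
rewrite /l1 mulr_sumr; apply: ler_sum => j _.
have -> : (w *: h) 0 j = w * h 0 j by rewrite mxE.
have H1 := modulus_Re (w * h 0 j); have H2 := modulus_Im (w * h 0 j).
rewrite modulusM in H1 H2.
have H3 : modulus w * modulus (h 0 j) <= modulus w * (`|Re (h 0 j)| + `|Im (h 0 j)|).
  by rewrite ler_wpM2l ?modulus_ge0// modulus_le_l1.
by rewrite -mulrA mulr_natl mulr2n lerD// (le_trans _ H3).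
Qed.

(** A common bound M on the remainders of all coordinates. *)
Lemma jet_curve (c : C -> V) : (forall j, jet (fun w => c w 0 j)) ->
  exists (b a : V) (r : C -> V) (M : R), [/\ 0 <= M,
    \forall w \near axes0, c w = c 0 + w *: b + w ^+ 2 *: a + w ^+ 3 *: r w &
    \forall w \near axes0, l1 (r w) <= M].
Proof.
move=> jc.
have : forall j, exists x : C * C * (C -> C) * R,
    (\forall w \near axes0, c w 0 j = c 0 0 j + x.1.1.1 * w + x.1.1.2 * w ^+ 2
                                      + w ^+ 3 * x.1.2 w) /\
    (\forall w \near axes0, modulus (x.1.2 w) <= x.2).
  move=> j; have [a0 [b [a [r [[M hM] hc]]]]] := jc j.
  exists (b, a, r, M); split=> //=.
  have -> : c 0 0 j = a0 by rewrite (axes0_at0 _ hc); ring.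
  exact: hc.
move=> /boolp.choice[x hx].
exists (\row_j (x j).1.1.1), (\row_j (x j).1.1.2), (fun w => \row_j (x j).1.2 w).
exists (\sum_j (2 * `|(x j).2|)); split.
- by apply: sumr_ge0 => j _; exact: mulr_ge0.
- have H := @filter_forall C 'I_N (fun j w => c w 0 j = c 0 0 j + (x j).1.1.1 * w
     + (x j).1.1.2 * w ^+ 2 + w ^+ 3 * (x j).1.2 w) axes0 axes0_filter (fun j => (hx j).1).
  apply: (filterS _ H) => w {}H; apply/rowP => j; rewrite H !mxE.
  by rewrite (mulrC w) (mulrC (w ^+ 2)).
- have H := @filter_forall C 'I_N (fun j w => modulus ((x j).1.2 w) <= (x j).2)
     axes0 axes0_filter (fun j => (hx j).2).
  apply: (filterS _ H) => w {}H; apply: ler_sum => j _; rewrite mxE mulr_natl mulr2n.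
  have H' := le_trans (H j) (ler_norm _).
  by rewrite lerD// (le_trans _ H') ?modulus_Re ?modulus_Im.
Qed.

Lemma levi_form_ge0 Om u z v : strictly_psh Om u -> Om z -> 0 <= levi_form u z v.
Proof.
move=> psh Oz; have [->|v0] := eqVneq v 0; last exact/ltW/psh.
have d0 (g : V -> R) : dir_deriv 0 g z = 0.
  rewrite /dir_deriv (_ : (fun t : R => _) = cst (g z)) ?derive1_cst//.
  by apply/funext => t; rewrite scaler0 addr0.
by rewrite /levi_form scaler0 !d0 addr0 mulr0.
Qed.

End SubmeanCurve.

Section SubmeanTheorems.
Context {R : realType} {N : nat}.
Local Notation C := (Cx R).
Local Notation V := 'rV[C]_N.
Implicit Types (u : V -> R) (v z p h : V) (Om : set V).

Lemma quadratic_remainder (a x : V) (w : C) (M : R) : modulus w <= 1 -> l1 x <= M ->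
  l1 (w ^+ 2 *: a + w ^+ 3 *: x) <= (2 * l1 a + 2 * M) * modulus w ^+ 2.
Proof.
move=> w1 xM; rewrite (le_trans (l1D _ _))// mulrDl; apply: lerD.
  by rewrite (le_trans (l1Z _ _))// modulusX mulrAC.
rewrite (le_trans (l1Z _ _))// modulusX mulrAC; apply: ler_pM.
- by rewrite mulr_ge0// l1_ge0.
- by rewrite exprn_ge0// modulus_ge0.
- by rewrite ler_wpM2l.
- by rewrite exprSr ler_piMr// exprn_ge0// modulus_ge0.
Qed.

Lemma modulus_i : modulus ('i%C : C) = 1.
Proof. by rewrite /modulus/= expr0n/= add0r expr1n sqrtr1. Qed.

(** The quadratic terms cancel, the squares of e, -e, ie, -ie having sum 0. *)
Lemma l1_four_remainders (a r1 r2 r3 r4 : V) (w1 w2 w3 w4 : C) (e M : R) :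
  w1 ^+ 2 + w2 ^+ 2 + w3 ^+ 2 + w4 ^+ 2 = 0 ->
  modulus w1 = e -> modulus w2 = e -> modulus w3 = e -> modulus w4 = e ->
  l1 r1 <= M -> l1 r2 <= M -> l1 r3 <= M -> l1 r4 <= M ->
  l1 ((w1 ^+ 2 *: a + w1 ^+ 3 *: r1) + (w2 ^+ 2 *: a + w2 ^+ 3 *: r2) +
      (w3 ^+ 2 *: a + w3 ^+ 3 *: r3) + (w4 ^+ 2 *: a + w4 ^+ 3 *: r4)) <= 8 * M * e ^+ 3.
Proof.
move=> w0 m1 m2 m3 m4 H1 H2 H3 H4.
have wE w x : modulus w = e -> l1 x <= M -> l1 (w ^+ 3 *: x : V) <= 2 * M * e ^+ 3.
  move=> we xM; rewrite (le_trans (l1Z _ _))// modulusX we mulrAC.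
  by rewrite ler_wpM2r ?exprn_ge0// -?we ?modulus_ge0// ler_wpM2l.
have := wE _ _ m1 H1; have := wE _ _ m2 H2; have := wE _ _ m3 H3; have := wE _ _ m4 H4.
rewrite (addrACA (w1 ^+ 2 *: a)) -scalerDl (addrACA ((w1 ^+ 2 + w2 ^+ 2) *: a)).
rewrite -scalerDl (addrACA ((w1 ^+ 2 + w2 ^+ 2 + w3 ^+ 2) *: a)) -scalerDl w0 scale0r add0r.
move: (w1 ^+ 3 *: r1) (w2 ^+ 3 *: r2) (w3 ^+ 3 *: r3) (w4 ^+ 3 *: r4) => x1 x2 x3 x4.
have := l1D (x1 + x2 + x3) x4; have := l1D (x1 + x2) x3; have := l1D x1 x2.
lra.
Qed.

(** The estimates of [spsh_submean], freed from the functions they come from: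
    p_i are values on the tangent line, l_i the corrections by the
    differential, v_i values on the curve. *)
Lemma four_point_arithmetic (D1 D2 v0 k KM B e p1 p2 p3 p4 l1 l2 l3 l4 v1 v2 v3 v4 : R) :
  0 < e -> 0 <= 4^-1 * (D1 + D2) -> 0 <= KM -> e * (32 * KM + 1) < k / 4 -> B <= k / 16 ->
  (D1 - k / 8) * e ^+ 2 <= p1 + p2 - 2 * v0 ->
  (D2 - k / 8) * e ^+ 2 <= p3 + p4 - 2 * v0 ->
  `|l1 + l2 + l3 + l4| <= 8 * KM * e ^+ 3 ->
  p1 + l1 - B * e ^+ 2 <= v1 -> p2 + l2 - B * e ^+ 2 <= v2 ->
  p3 + l3 - B * e ^+ 2 <= v3 -> p4 + l4 - B * e ^+ 2 <= v4 ->
  4 * v0 - k * e ^+ 2 <= v1 + v2 + v3 + v4.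
Proof.
move=> e0 D0 KM0 eK Bk T1 T2; rewrite ler_norml => /andP[LQ _] U1 U2 U3 U4.
have e2 : 0 <= e ^+ 2 by rewrite exprn_ge0// ltW.
have D0' : 0 <= (D1 + D2) * e ^+ 2 by rewrite mulr_ge0//; lra.
have eK' : 8 * KM * e ^+ 3 <= k / 16 * e ^+ 2.
  have -> : 8 * KM * e ^+ 3 = (8 * KM * e) * e ^+ 2 by ring.
  by rewrite ler_wpM2r//; lra.
have Bk' : B * e ^+ 2 <= k / 16 * e ^+ 2 by rewrite ler_wpM2r.
have k0 : 0 <= k * e ^+ 2.
  have : 0 <= e * (32 * KM + 1) by apply: mulr_ge0; lra.
  by move=> H; apply: mulr_ge0 => //; lra.
lra.
Qed.

(** Along the tangent line of c at 0 the sum of the two second differences, in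
    the directions b and i b, is e^2 times four times the Levi form, up to
    o(e^2). Leaving the tangent line for the curve changes the values by the
    differential of u applied to displacements that are quadratic in w, and
    these cancel in the sum up to O(e^3). *)
Lemma spsh_submean Om u (c : C -> V) (k : R) : open Om -> smooth Om u ->
  strictly_psh Om u -> (forall j, jet (fun w => c w 0 j)) -> Om (c 0) -> 0 < k ->
  \forall e \near (0 : R)^'+, 4 * u (c 0) - k * e ^+ 2 <= sum4 (fun w => u (c w)) e.
Proof.
move=> oOm su psh jc Oc k0.
have [b [a [r [M [M0 hc hr]]]]] := jet_curve c jc.
pose q w := w ^+ 2 *: a + w ^+ 3 *: r w.
pose M1 := 2 * l1 a + 2 * M.
have M10 : 0 <= M1 by have := l1_ge0 a; rewrite /M1; lra.
(* M1 w^2 bounds the displacement, and 4 k1 M1 <= k / 4. *)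
pose k1 := k / (16 * (M1 + 1)).
have k10 : 0 < k1 by apply: divr_gt0 => //; lra.
have k1M : k1 * M1 <= k / 16.
  have -> : k / 16 = k1 * (M1 + 1).
    by rewrite /k1; field; rewrite gt_eqF//; lra.
  by rewrite ler_pM2l//; lra.
have [d d0 hd] := Ck_strict_differential Om u (c 0) k1 oOm (su 1%N) Oc k10.
have [K K0 hK] := real_linear_bound (fun j => dir_deriv (unit_re j) u (c 0))
              (fun j => dir_deriv (unit_im j) u (c 0)).
have := real_linearD (fun j => dir_deriv (unit_re j) u (c 0))
              (fun j => dir_deriv (unit_im j) u (c 0)).
have k8 : 0 < k / 8 by lra.
have S1 := line_second_difference Om u (c 0) b (k / 8) oOm (su 2%N) Oc k8.
have S2 := line_second_difference Om u (c 0) ('i%C *: b) (k / 8) oOm (su 2%N) Oc k8.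
have := levi_form_ge0 Om u (c 0) b psh Oc.
move: S1 S2 hd hK; rewrite /levi_form /differential.
move: (dir_deriv b _ _) (dir_deriv ('i%C *: b) _ _) (real_linear _ _) => D1 D2 L.
move=> S1 S2 hd hK levi LD.
have {hd} P : \forall w \near axes0, [/\ c w = c 0 + w *: b + q w,
    u (c 0 + w *: b) + L (q w) - k1 * (M1 * modulus w ^+ 2) <= u (c w)
    & l1 (r w) <= M].
  pose Kb := \sum_j modulus (b 0 j).
  have Kb0 : 0 <= Kb by apply: sumr_ge0 => j _; exact: modulus_ge0.
  near=> w.
  have w1 : modulus w < 1 by near: w; exact: near0_small.
  have wd : modulus w < d / (Kb + M1 + 1).
    by near: w; apply: near0_small; apply: divr_gt0 => //; lra.
  have rM : l1 (r w) <= M by near: w.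
  have cw : c w = c 0 + w *: b + q w by rewrite addrA; near: w.
  split=> //.
  have qM : l1 (q w) <= M1 * modulus w ^+ 2.
    by apply: quadratic_remainder => //; exact: ltW.
  rewrite ltr_pdivlMr in wd; last by lra.
  have w0 := modulus_ge0 w.
  have := hd (c 0 + w *: b) (q w).
  rewrite -cw => /(_ _ _)/wrap[].
    move=> j; have -> : (c 0 + w *: b) 0 j - c 0 0 j = w * b 0 j.
      by rewrite !mxE addrAC subrr add0r.
    rewrite modulusM (le_lt_trans _ wd)// ler_wpM2l//.
    rewrite (@le_trans _ _ Kb)//; last by lra.
    rewrite /Kb (bigD1 j)//= lerDl.
    by apply: sumr_ge0 => i _; exact: modulus_ge0.
  - rewrite (le_lt_trans qM)// (le_lt_trans _ wd)//.
    rewrite expr2 ; move: (modulus w) w0 w1 => x x0 x1.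
    rewrite mulrCA ler_wpM2l// (@le_trans _ _ M1)//; first exact: (ler_piMr M10 (ltW x1)).
    clear -Kb0; lra.
  have k1q : k1 * l1 (q w) <= k1 * (M1 * modulus w ^+ 2) by rewrite ler_pM2l.
  by rewrite ler_norml => /andP[+ _]; lra.
have {hc hr} P4 := near_four_points _ P.
have KM1 : 0 < 32 * (K * M) + 1 by rewrite ltr_wpDl// mulr_ge0// mulr_ge0.
have bound : 0 < k / 4 / (32 * (K * M) + 1) by rewrite !divr_gt0.
near=> e.
have e0 : 0 < e by [].
have eK : e * (32 * (K * M) + 1) < k / 4.
  by rewrite -ltr_pdivlMr//; near: e; exact: nbhs_right_lt.
have [] := near P4 e _ => //.
move=> [_ U1 R1] [_ U2 R2] [_ U3 R3] [_ U4 R4].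
have T1 : (D1 - k / 8) * e ^+ 2 <= u (c 0 + (e%:C%C : C) *: b) +
    u (c 0 + ((- e)%:C%C : C) *: b) - 2 * u (c 0) by near: e.
have T2 : (D2 - k / 8) * e ^+ 2 <= u (c 0 + (('i * e%:C)%C : C) *: b) +
    u (c 0 + (('i * (- e)%:C)%C : C) *: b) - 2 * u (c 0).
  rewrite ![('i * _)%C]mulrC -!scalerA; near: e; exact: S2.
have m w : modulus (w%:C%C : C) = `|w| := modulus_real w.
have mi w : modulus (('i * w%:C)%C : C) = `|w| by rewrite modulusM modulus_i mul1r m.
have := l1_four_remainders a _ _ _ _ (e%:C)%C ((- e)%:C)%C ('i * e%:C)%C ('i * (- e)%:C)%C e M.
rewrite !m !mi !normrN (gtr0_norm e0) in U1 U2 U3 U4 *.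
move=> /(_ _ _ _ _ _ erefl erefl erefl erefl R1 R2 R3 R4)/wrap[].
  have -> : ((- e)%:C)%C = - (e%:C)%C :> C.
    by apply/eqP; rewrite eq_complex /= oppr0 !eqxx.
  rewrite mulrN !sqrrN exprMn sqr_i; ring.
have L4 (x1 x2 x3 x4 : V) : L (x1 + x2 + x3 + x4) = L x1 + L x2 + L x3 + L x4.
  by rewrite !LD.
move=> /(ler_wpM2l K0) /(le_trans (hK _)); rewrite L4 => LQ.
rewrite (_ : K * (8 * M * e ^+ 3) = 8 * (K * M) * e ^+ 3) in LQ; last by ring.
rewrite (mulrA k1 M1) in U1 U2 U3 U4.
rewrite /sum4.
exact: (four_point_arithmetic _ _ _ _ _ _ _ _ _ _ _ _ _ _ _ _ _ _ _ e0 levi (mulr_ge0 K0 M0) eK k1M T1 T2 LQ U1 U2 U3 U4).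
Unshelve. all: by end_near.
Qed.

End SubmeanTheorems.

(** * The logarithm of the modulus of a holomorphic function *)

Section LogModulus.
Context {R : realType}.
Local Notation C := (Cx R).

Lemma axes0_rot (A : set C) : axes0 A -> axes0 (fun w => A ('i%C * w)).
Proof.
move=> /axes0P[d d0 H]; apply/axes0P; exists d => // w ax wd; apply: H.
  by case: w ax wd => a b [ax|ax] _; move: ax => /= ->; [right|left];
    rewrite /= ?mulr0 ?mul0r ?mul1r ?subr0 ?add0r ?oppr0.
by rewrite modulusM modulus_i mul1r.
Qed.

Lemma axes0N (A : set C) : axes0 A -> axes0 (fun w => A (- w)).
Proof.
move=> /axes0_rot/axes0_rot; apply: filterS => w.
by rewrite mulrA -expr2 sqr_i mulN1r.
Qed.

Lemma bounded_rot r : bounded_near r -> bounded_near (fun w : C => r ('i%C * w)).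
Proof. by move=> [M hM]; exists M; exact: (axes0_rot _ hM). Qed.

Lemma bounded_opp r : bounded_near r -> bounded_near (fun w : C => r (- w)).
Proof. by move=> [M hM]; exists M; exact: (axes0N _ hM). Qed.

(** Multiplying the values at w and -w kills the linear term, and multiplying
    then the results at w and i w kills the quadratic one. *)
Lemma jet_four_product (f : C -> C) : jet f -> f 0 = 1 ->
  exists2 r, bounded_near r & \forall w \near axes0,
    f w * f (- w) * f ('i%C * w) * f ('i%C * (- w)) = 1 + w ^+ 3 * r w.
Proof.
move=> [a [b [c [r [br hf]]]]] f0.
have a1 : a = 1 by rewrite -f0 (axes0_at0 _ hf); ring.
subst a; pose d := 2 * c - b ^+ 2.
pose A w := c ^+ 2 * w - r (- w) * (1 + b * w + c * (w * w)) +
   r w * (1 - b * w + c * (w * w)) - (w * w * w) * (r w * r (- w)).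
have bA : bounded_near A.
  by do ?[apply: boundedD|apply: boundedM|apply: boundedN|exact: bounded_cst
         |exact: bounded_id|exact: bounded_opp|done].
have hA : \forall w \near axes0, f w * f (- w) = 1 + d * w ^+ 2 + w ^+ 3 * A w.
  have hf' := axes0N _ hf.
  near=> w; rewrite (near hf w _)// (near hf' w _)// /A /d; ring.
clearbody A; exists (fun w => - (d ^+ 2) * w + A w * (1 - d * (w * w))
   - 'i%C * A ('i%C * w) * (1 + d * (w * w)) - 'i%C * (w * w * w) * (A w * A ('i%C * w))).
  by do ?[apply: boundedD|apply: boundedM|apply: boundedN|exact: bounded_cst
         |exact: bounded_id|exact: bounded_rot|done].
have hA' := axes0_rot _ hA.
near=> w; rewrite (near hA w _)// -mulrA mulrN (near hA' w _)//.
rewrite !exprMn (_ : 'i%C ^+ 3 = - 'i%C :> C); last by rewrite exprSr sqr_i mulN1r.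
rewrite sqr_i; ring.
Unshelve. all: by end_near.
Qed.

(** The discrete form of the subharmonicity of -log|f|^2: the four logarithms
    add up to the one of a product that is 1 + O(e^3) after division by
    f(0)^4. *)
Lemma log_modulus_mean (f : C -> C) (k : R) : jet f -> f 0 != 0 -> 0 < k ->
  \forall e \near (0 : R)^'+,
    sum4 (fun w => ln (modulus (f w) ^+ 2)) e <= 4 * ln (modulus (f 0) ^+ 2) + k * e ^+ 2.
Proof.
move=> jf f0 k0.
have jg : jet (fun w => f w * (f 0)^-1) by apply: jetM => //; exact: jet_cst.
have [r [M hM] hr] := jet_four_product _ jg (divff f0).
have P4 := near_four_points _ (jet_neq0 _ jf f0).
have Q4 : \forall e \near (0 : R)^'+, modulus (r (e%:C)%C) <= M /\
    (fun w : C => f w / f 0 * (f (- w) / f 0) * (f ('i%C * w) / f 0) *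
       (f ('i%C * (- w)) / f 0) = 1 + w ^+ 3 * r w) (e%:C)%C.
  by apply: filterS (near_four_points _ (filterI hM hr)) => e [].
have M1 : 0 < 2 * `|M| + 1 by rewrite ltr_wpDl// mulr_ge0.
near=> e.
have e0 : 0 < e by [].
have eK : e * (2 * `|M| + 1) < k.
  by rewrite -ltr_pdivlMr//; near: e; apply: nbhs_right_lt; exact: divr_gt0.
have [n1 n2 n3 n4] : [/\ f (e%:C)%C != 0, f ((- e)%:C)%C != 0, f ('i * e%:C)%C != 0 &
   f ('i * (- e)%:C)%C != 0] by near: e.
have [rM fe] : modulus (r (e%:C)%C) <= M /\
    (fun w : C => f w / f 0 * (f (- w) / f 0) * (f ('i%C * w) / f 0) *
       (f ('i%C * (- w)) / f 0) = 1 + w ^+ 3 * r w) (e%:C)%C by near: e.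
have eN : - (e%:C)%C = ((- e)%:C)%C :> C by apply/eqP; rewrite eq_complex /= oppr0 !eqxx.
rewrite eN in fe.
rewrite /sum4; cbv beta.
have := congr1 (@modulus R) fe; rewrite !modulusM !modulusV.
have : modulus (1 + (e%:C%C : C) ^+ 3 * r (e%:C)%C) <= 1 + e ^+ 3 * `|M|.
  rewrite (le_trans (modulusD _ _))// modulus1 lerD2l modulusM modulusX modulus_real.
  by rewrite gtr0_norm// ler_wpM2l ?exprn_ge0 ?(ltW e0)// (le_trans rM)// ler_norm.
move=> + E; rewrite -{}E.
rewrite -!modulus_gt0 in n1 n2 n3 n4 f0.
move: (modulus (f (e%:C)%C)) (modulus (f ((- e)%:C)%C)) (modulus (f ('i * e%:C)%C))
  (modulus (f ('i * (- e)%:C)%C)) (modulus (f 0)) n1 n2 n3 n4 f0 => x1 x2 x3 x4 x0 n1 n2 n3 n4 f0 H.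
have := @ler_ln R; move=> /(_ (x1 / x0 * (x2 / x0) * (x3 / x0) * (x4 / x0)) (1 + e ^+ 3 * `|M|)).
have p1 : 0 < 1 + e ^+ 3 * `|M| by rewrite ltr_wpDr// mulr_ge0// exprn_ge0// (ltW e0).
rewrite !posrE !mulr_gt0 ?invr_gt0// => /(_ isT p1); rewrite H => H1.
have H2 : ln (1 + e ^+ 3 * `|M|) <= e ^+ 3 * `|M|.
  by apply: le_ln1Dx; rewrite (@lt_le_trans _ _ 0)// mulr_ge0// exprn_ge0// (ltW e0).
move: (le_trans H1 H2); rewrite !lnM ?posrE ?mulr_gt0 ?invr_gt0// !lnV ?posrE//.
have : e ^+ 3 * (2 * `|M|) <= k * e ^+ 2.
  rewrite (_ : e ^+ 3 * (2 * `|M|) = e * (2 * `|M|) * e ^+ 2); last by ring.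
  by rewrite ler_wpM2r ?exprn_ge0 ?(ltW e0)//; lra.
lra.
Unshelve. all: by end_near.
Qed.

End LogModulus.

(** * Coordinates and topology of projective space *)

Section ProjectiveCoordinates.
Context {R : realType} {N : nat}.
Local Notation C := (Cx R).
Local Notation P := (proj_space R N).
Local Notation W := 'rV[C]_N.+1.
Implicit Types (z w : W) (x : P).

Lemma hcoord_neq0 x : hcoord x != 0.
Proof. exact: (valP (repr x)). Qed.

Lemma nonzero_coord z : z != 0 -> exists k, z 0 k != 0.
Proof.
move=> z0; apply/existsP; apply: contraR z0 => /existsPn H.
by apply/eqP/rowP => j; rewrite mxE; apply/eqP; move: (H j); rewrite negbK.
Qed.

Lemma pt_hcoord x : pt (hcoord x) = x.
Proof.
rewrite /pt /hcoord /nonzero_val.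
have -> : insubd (Sub (const_mx 1) (const1_neq0 R N) : nonzero_vec R N) (sval (repr x)) = repr x.
  by apply: val_inj; rewrite val_insubd (valP (repr x)).
exact: reprK.
Qed.

Lemma pt_line z w : z != 0 -> w != 0 -> (pt z = pt w) <-> exists2 a : C, a != 0 & z = a *: w.
Proof.
move=> z0 w0.
set c := (Sub (const_mx 1) (const1_neq0 R N) : nonzero_vec R N).
have zE : nonzero_val (insubd c z) = z by exact: insubdK.
have wE : nonzero_val (insubd c w) = w by exact: insubdK.
have -> : (pt z = pt w) <-> (z == w)%MS.
  rewrite /pt; split.
    by move=> /eqmodP; rewrite /= zE wE.
  by move=> H; apply/eqmodP; rewrite /= zE wE.
split => [/andP[/sub_rVP[a za] _]|[a a0 ->]].
  by exists a => //; apply: contra z0 => /eqP a0; rewrite za a0 scale0r.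
exact/eqmxP/eqmx_scale.
Qed.

Lemma hcoord_pt z : z != 0 -> exists2 a : C, a != 0 & hcoord (pt z) = a *: z.
Proof. by move=> z0; apply/pt_line => //; [exact: hcoord_neq0|exact: pt_hcoord]. Qed.

Lemma ev_pt (d : nat) (p : mpoly N.+1 C) z : homog d p -> z != 0 ->
  exists2 a : C, a != 0 & hcoord (pt z) = a *: z /\
    ev p (pt z) = a ^+ d * meval (fun j => z 0 j) p.
Proof.
move=> hp z0; have [a a0 az] := hcoord_pt z z0; exists a => //; split=> //.
rewrite /ev az !mevalE mulr_sumr; apply: eq_big_seq => m mp.
rewrite mulrCA; congr (_ * _).
have <- : mdeg m = d := dhomog_mf hp mp.
rewrite mdegE -prodrXr -big_split /=.
by apply: eq_bigr => j _; rewrite mxE exprMn.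
Qed.

End ProjectiveCoordinates.

Section ProjectiveTopology.
Context {R : realType} {N : nat}.
Local Notation C := (Cx R).
Local Notation P := (proj_space R N).
Local Notation W := 'rV[C]_N.+1.
Local Notation V := 'rV[C]_N.
Implicit Types (z w y : W) (a : V) (x : P).

Definition affine (k : 'I_N.+1) z : V := \row_i (z 0 (lift k i) / z 0 k).
Definition homogenize (k : 'I_N.+1) a : W :=
  \row_j (if unlift k j is Some i then a 0 i else 1).

Lemma homogenize_neq0 k a : homogenize k a != 0.
Proof.
apply/eqP => /rowP/(_ k); rewrite !mxE unlift_none; apply/eqP; exact: oner_neq0.
Qed.

Lemma homogenize_affine k z : z 0 k != 0 -> z = z 0 k *: homogenize k (affine k z).
Proof.
move=> zk; apply/rowP => j; rewrite !mxE; case: unliftP => [i ->|->].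
  by rewrite !mxE mulrCA divff// mulr1.
by rewrite mulr1.
Qed.

Lemma affineZ k (c : C) z : c != 0 -> affine k (c *: z) = affine k z.
Proof.
by move=> c0; apply/rowP => i; rewrite !mxE invfM mulrACA divff// mul1r.
Qed.

Lemma affine_homogenize k a : affine k (homogenize k a) = a.
Proof. by apply/rowP => i; rewrite !mxE liftK unlift_none divr1. Qed.

Lemma pt_chart k z : z 0 k != 0 -> pt z = chart k (affine k z).
Proof.
move=> zk; apply/pt_line; [|exact: homogenize_neq0|].
  by apply: contra zk => /eqP ->; rewrite mxE.
by exists (z 0 k) => //; exact: homogenize_affine.
Qed.

Lemma coord_neq0 k z : z 0 k != 0 -> z != 0.
Proof. by apply: contra => /eqP ->; rewrite mxE. Qed.

Lemma near_coord_neq0 k z : z 0 k != 0 -> \forall y \near z, (y : W) 0 k != 0.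
Proof.
move=> zk; apply/nbhs_rVP; exists (modulus (z 0 k)); first by rewrite modulus_gt0.
by move=> y /(_ k); apply: contraTneq => ->; rewrite sub0r modulusN ltxx.
Qed.

(** The continuity of the projection from nonzero vectors to lines. *)
Lemma near_pt z (O : set P) : z != 0 -> open O -> O (pt z) ->
  \forall y \near z, y != 0 /\ O (pt y).
Proof.
move=> z0 oO Oz.
set c := (Sub (const_mx 1) (const1_neq0 R N) : nonzero_vec R N).
have [B oB BE] : open ((\pi_P : nonzero_vec R N -> P) @^-1` O).
  by exact: oO.
have Bz : B z.
  have : ((@nonzero_val R N) @^-1` B) (insubd c z) by rewrite BE; exact: Oz.
  by rewrite /= /nonzero_val insubdK.
have [k zk] := nonzero_coord z z0.
near=> y.
have yk : y 0 k != 0 by near: y; exact: near_coord_neq0.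
have y0 := coord_neq0 k y yk; split=> //.
suff : (\pi_P @^-1` O) (insubd c y) by [].
by rewrite -BE /= /nonzero_val insubdK//; near: y; exact: open_nbhs_nbhs.
Unshelve. all: by end_near.
Qed.

Lemma near_affine k z (A : set V) : z 0 k != 0 -> nbhs (affine k z) A ->
  \forall y \near z, A (affine k y).
Proof.
move=> zk /nbhs_rVP[d d0 hd].
have H i : \forall y \near z, modulus ((y : W) 0 (lift k i) / y 0 k - z 0 (lift k i) / z 0 k) < d.
  have cc j : (fun y : W => y 0 j : C) @ z --> (z 0 j : C).
    move=> B /nbhs_CxP[e e0 he]; apply/nbhs_rVP; exists e => // y hy; exact: he.
  have : (fun y : W => y 0 (lift k i) / y 0 k : C) @ z --> (z 0 (lift k i) / z 0 k : C).
    have FF : ProperFilter (nbhs z) := nbhs_pfilter z.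
    apply: (@cvgM _ _ (nbhs z) FF); first exact: cc.
    by apply: (@cvgV _ _ (nbhs z) FF) => //; exact: cc.
  move=> cv; apply: (cv [set w : C | modulus (w - z 0 (lift k i) / z 0 k) < d]).
  by apply/nbhs_CxP; exists d.
apply: (filterS _ (filter_forall _ H)) => y hy; apply: hd => i; rewrite !mxE; exact: hy.
Qed.

Lemma pi_pt (v : nonzero_vec R N) : \pi_P v = pt (nonzero_val v).
Proof.
rewrite /pt; congr (\pi_P _); apply: val_inj; rewrite val_insubd.
by rewrite (valP v).
Qed.

Lemma open_chart_image k (Om : set V) : open Om ->
  open [set x : P | hcoord x 0 k != 0 /\ Om (affine k (hcoord x))].
Proof.
move=> oOm.
have oB : open [set z : W | z 0 k != 0 /\ Om (affine k z)].
  rewrite openE => z [zk Oz]; apply: filterI; first by apply: near_coord_neq0.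
  by apply: near_affine => //; exact: open_nbhs_nbhs.
suff : open ((\pi_P : nonzero_vec R N -> P) @^-1`
    [set x : P | hcoord x 0 k != 0 /\ Om (affine k (hcoord x))]) by [].
exists [set z : W | z 0 k != 0 /\ Om (affine k z)] => //.
apply/seteqP; split=> v; have v0 : nonzero_val v != 0 by exact: (valP v).
  have [a a0 E] := hcoord_pt (nonzero_val v) v0.
  move=> [vk Ov]; rewrite /preimage /mkset pi_pt E affineZ//; split=> //.
  by rewrite mxE mulf_neq0.
have [a a0 E] := hcoord_pt (nonzero_val v) v0.
rewrite /preimage /mkset pi_pt E affineZ// mxE mulf_eq0 (negbTE a0) => -[vk Ov].
by split.
Qed.

Lemma chart_hcoord k x : hcoord x 0 k != 0 -> chart k (affine k (hcoord x)) = x.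
Proof. by move=> xk; rewrite -pt_chart// pt_hcoord. Qed.

Lemma hcoord_chart k a : hcoord (chart k a) 0 k != 0 /\ affine k (hcoord (chart k a)) = a.
Proof.
have [c c0 E] := hcoord_pt (homogenize k a) (homogenize_neq0 k a).
rewrite [chart k a]/(pt (homogenize k a)) E affineZ// affine_homogenize; split=> //.
by rewrite !mxE unlift_none mulr1.
Qed.

End ProjectiveTopology.

Section ProjectiveContinuity.
Context {R : realType} {N : nat}.
Local Notation C := (Cx R).
Local Notation P := (proj_space R N).
Local Notation W := 'rV[C]_N.+1.
Local Notation V := 'rV[C]_N.
Implicit Types (z w y : W) (a : V) (x : P) (U : set P).

(** Charts are open maps, so that neighborhoods in the affine chart, where
    smoothness is defined, are neighborhoods in projective space. *)
Lemma near_chart k a (A : set V) : nbhs a A ->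
  \forall x \near chart k a, hcoord x 0 k != 0 /\ A (affine k (hcoord x)).
Proof.
rewrite nbhsE => -[B [oB Ba] BA].
have := open_chart_image k B oB; rewrite openE => /(_ (chart k a)).
have [h1 h2] := hcoord_chart k a.
move=> /(_ (conj h1 _)); rewrite h2 => /(_ Ba).
by apply: filterS => x [xk /BA].
Qed.

Lemma chart_surj x : exists k a, x = chart k a.
Proof.
have [k xk] := nonzero_coord _ (hcoord_neq0 x).
by exists k, (affine k (hcoord x)); rewrite chart_hcoord.
Qed.

Lemma locally_extends_cvg U (E : set V -> (V -> R) -> Prop) (f : P -> R) x :
  (forall Om F, E Om F -> forall a, Om a -> {for a, continuous F}) ->
  locally_extends U E f -> U x -> f @ within U (nbhs x) --> f x.
Proof.
move=> cE ext; have [k [a ->]] := chart_surj x => Ux.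
have [Om [F [oOm Oa EF Ff]]] := ext k a Ux.
have Fa := cE _ _ EF a Oa.
apply/cvgrPdist_lt => e e0; rewrite near_withinE.
have nA : nbhs a (Om `&` [set b | `|F a - F b| < e]).
  apply: filterI; first exact: open_nbhs_nbhs.
  by move/cvgrPdist_lt: Fa => /(_ e e0).
apply: filterS (near_chart k a _ nA) => y [yk [Oy Fy]] Uy.
have yE := chart_hcoord k y yk.
have := Ff _ Oa Ux; have := Ff _ Oy; rewrite yE => /(_ Uy) <- <-.
exact: Fy.
Qed.

Section ComplexLimits.
Context (T : Type) (F : set_system T).
Context {FF : Filter F}.
Implicit Types (f g : T -> C).

Lemma cvgM_Cx f g (a b : C) : f @ F --> a -> g @ F --> b ->
  (fun t => f t * g t) @ F --> (a * b : C).
Proof. by move=> fa gb; exact: (@cvgM R[i] _ F FF f g a b fa gb). Qed.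

Lemma cvgD_Cx f g (a b : C) : f @ F --> a -> g @ F --> b ->
  (fun t => f t + g t) @ F --> (a + b : C).
Proof. by move=> fa gb; exact: (@cvgD R[i] C _ F FF f g a b fa gb). Qed.

Lemma cvgV_Cx f (a : C) : a != 0 -> f @ F --> a ->
  (fun t => (f t)^-1) @ F --> (a^-1 : C).
Proof. by move=> a0 fa; exact: (@cvgV R[i] _ F FF f a a0 fa). Qed.

Lemma cvgX_Cx f (a : C) k : f @ F --> a ->
  (fun t => f t ^+ k) @ F --> (a ^+ k : C).
Proof.
move=> fa; elim: k => [|k IH].
  by rewrite expr0; under eq_fun do rewrite expr0; exact: cvg_cst.
rewrite exprS; under eq_fun do rewrite exprS; exact: (cvgM_Cx _ _ _ _ fa IH).
Qed.

Lemma cvg_prod_Cx (I : Type) (s : seq I) (h : I -> T -> C) (l : I -> C) :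
  (forall i, h i @ F --> l i) ->
  (fun t => \prod_(i <- s) h i t) @ F --> (\prod_(i <- s) l i : C).
Proof.
move=> hl; elim: s => [|i s IH].
  by rewrite big_nil; under eq_fun do rewrite big_nil; exact: cvg_cst.
rewrite big_cons; under eq_fun do rewrite big_cons.
exact: (cvgM_Cx _ _ _ _ (hl i) IH).
Qed.

Lemma cvg_sum_Cx (I : Type) (s : seq I) (h : I -> T -> C) (l : I -> C) :
  (forall i, h i @ F --> l i) ->
  (fun t => \sum_(i <- s) h i t) @ F --> (\sum_(i <- s) l i : C).
Proof.
move=> hl; elim: s => [|i s IH].
  by rewrite big_nil; under eq_fun do rewrite big_nil; exact: cvg_cst.
rewrite big_cons; under eq_fun do rewrite big_cons.
exact: (cvgD_Cx _ _ _ _ (hl i) IH).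
Qed.

Lemma cvg_meval (n : nat) (f : 'I_n -> T -> C) (l : 'I_n -> C) (p : mpoly n C) :
  (forall j, f j @ F --> l j) ->
  (fun t => meval (f^~ t) p) @ F --> (meval l p : C).
Proof.
move=> fl; rewrite mevalE; under eq_fun do rewrite mevalE.
apply: cvg_sum_Cx => m; apply: (cvgM_Cx _ _ _ _ (cvg_cst _)).
by apply: cvg_prod_Cx => j; exact: cvgX_Cx.
Qed.

End ComplexLimits.

Lemma ev_pt_neq0 (d : nat) (p : mpoly N.+1 C) z : homog d p -> z != 0 ->
  (ev p (pt z) != 0) = (meval (fun j => z 0 j) p != 0).
Proof.
move=> hp z0; have [c c0 [_ ->]] := ev_pt d p z hp z0.
by rewrite mulf_eq0 expf_eq0 (negbTE c0) andbF.
Qed.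

(** The scalar by which the chosen representative differs from z cancels. *)
Lemma ev_pt_ratio (d : nat) (p q : mpoly N.+1 C) z : homog d p -> homog d q ->
  z != 0 ->
  ev p (pt z) / ev q (pt z) =
  meval (fun j => z 0 j) p / meval (fun j => z 0 j) q.
Proof.
move=> hp hq z0; have [c c0 E] := hcoord_pt z z0.
have scale e (s : mpoly N.+1 C) : homog e s ->
    ev s (pt z) = c ^+ e * meval (fun j => z 0 j) s.
  move=> hs; have [c' c'0 [E' ->]] := ev_pt e s z hs z0.
  have [k zk] := nonzero_coord z z0.
  suff -> : c' = c by [].
  by apply: (mulIf zk); move: E'; rewrite E => /rowP/(_ k); rewrite !mxE.
rewrite (scale d p hp) (scale d q hq) invfM mulrACA divff ?mul1r//.
by rewrite expf_neq0.
Qed.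

Lemma cvg_meval_homogenize k (a : V) (p : mpoly N.+1 C) :
  (fun b : V => meval (fun j => homogenize k b 0 j) p) @ nbhs a -->
  (meval (fun j => homogenize k a 0 j) p : C).
Proof.
apply: (cvg_meval V (nbhs a) _ (fun j b => homogenize k b 0 j) _ p) => j.
case E : (unlift k j) => [i|] B.
  have H b : homogenize k b 0 j = b 0 i by rewrite mxE E.
  rewrite H => /nbhs_CxP[e e0 he]; apply/nbhs_rVP; exists e => // y hy.
  by rewrite /= H; exact: he.
have H b : homogenize k b 0 j = 1 by rewrite mxE E.
rewrite H => /nbhs_singleton B1; apply/nbhs_rVP; exists 1 => // y _.
by rewrite /= H.
Qed.

Lemma near_meval_neq0 k (a : V) (p : mpoly N.+1 C) :
  meval (fun j => homogenize k a 0 j) p != 0 ->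
  \forall b \near a, meval (fun j => homogenize k b 0 j) p != 0.
Proof.
move=> p0; apply: (cvg_meval_homogenize k a p [set w : C | w != 0]).
apply/nbhs_CxP; exists (modulus (meval (fun j => homogenize k a 0 j) p)).
  by rewrite modulus_gt0.
by move=> w; apply: contraTneq => ->; rewrite sub0r modulusN ltxx.
Qed.

Lemma near_ev_neq0 d (p : mpoly N.+1 C) x : homog d p -> ev p x != 0 ->
  \forall y \near x, ev p y != 0.
Proof.
move=> hp; have [k [a ->]] := chart_surj x.
have chE (b : V) : @chart R N k b = pt (homogenize k b) by [].
rewrite chE (ev_pt_neq0 d p _ hp (homogenize_neq0 k a)) => /near_meval_neq0 pa.
have := near_chart k a _ pa; rewrite chE; apply: filterS => y [yk py].
rewrite -(chart_hcoord k y yk) chE.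
by rewrite (ev_pt_neq0 d p _ hp (homogenize_neq0 k _)).
Qed.

(** The Zariski topology is coarser than the complex one. *)
Lemma near_zopen (X U : set P) x : zopen_in X U -> U x ->
  \forall y \near x, X y -> U y.
Proof.
move=> [Z [S [hS ZE]] ->] [Xx Zx].
have [p Sp px] : exists2 p, S p & ev p x != 0.
  apply: contrapT => H; apply: Zx; rewrite ZE => p Sp.
  by apply: contrapT => /eqP px; apply: H; exists p.
have [d hp] := hS p Sp.
apply: filterS (near_ev_neq0 d p x hp px) => y py Xy; split=> //.
by rewrite ZE => /(_ p Sp)/eqP; rewrite (negbTE py).
Qed.

Lemma regular_cvg U (g : P -> C) x : regular_on U g -> U x ->
  g @ within U (nbhs x) --> (g x : C).
Proof.
move=> gU Ux; have [d [p [q [hp hq qx gE]]]] := gU x Ux.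
have [k [a xE]] := chart_surj x; rewrite {}xE in Ux qx *.
have hc (b : V) := homogenize_neq0 k b.
have chE (b : V) : @chart R N k b = pt (homogenize k b) by [].
pose ph (b : V) : C := meval (fun j => homogenize k b 0 j) p.
pose qh (b : V) : C := meval (fun j => homogenize k b 0 j) q.
have FF : ProperFilter (nbhs a) := nbhs_pfilter a.
have cp : ph @ nbhs a --> (ph a : C).
  exact: cvg_meval_homogenize.
have cq : qh @ nbhs a --> (qh a : C).
  exact: cvg_meval_homogenize.
have qa : qh a != 0.
  by rewrite chE (ev_pt_neq0 d q _ hq (hc a)) in qx.
have cr : (fun b => ph b / qh b) @ nbhs a --> (ph a / qh a : C).
  exact: (cvgM_Cx V (nbhs a) _ _ _ _ cp (cvgV_Cx V (nbhs a) _ _ qa cq)).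
have gh b : U (chart k b) -> qh b != 0 -> g (chart k b) = ph b / qh b.
  move=> Ub qb; rewrite (gE _ Ub); first by rewrite chE; exact: (ev_pt_ratio d p q _ hp hq (hc b)).
  by rewrite chE (ev_pt_neq0 d q _ hq (hc b)).
have qn : \forall b \near a, qh b != 0.
  exact: near_meval_neq0.
move=> B; rewrite (gh _ Ux qa) => Bx.
have crB : nbhs a [set b : V | B (ph b / qh b)] := cr B Bx.
have H : \forall y \near chart k a, U y -> B (g y).
  have nB : nbhs a [set b : V | B (ph b / qh b) /\ qh b != 0] .
    exact: (@filterI _ (nbhs a) FF _ _ crB qn).
  have := near_chart k a _ nB; apply: filterS => y [yk [By qy]] Uy.
  have gy := gh (affine k (hcoord y)); rewrite (chart_hcoord k y yk) in gy.
  by rewrite (gy Uy qy).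
exact: H.
Qed.

End ProjectiveContinuity.

(** * Norms of sections of powers of a line bundle *)

Section SectionNorm.
Context {R : realType} {N r : nat} {X : set (proj_space R N)}.
Local Notation C := (Cx R).
Local Notation P := (proj_space R N).
Local Notation TT := 'rV[C]_r.
Context (L : line_bundle X) (nrm : tot L -> R).
Context (act : TT -> P -> P) (actL : TT -> tot L -> tot L).
Implicit Types (x : P) (v : tot L).

Lemma frame_at (a : tidx L) x : tdom a x -> exists2 v, prj v = x & triv a v = 1.
Proof. by move=> ax; have [v [[]]] := triv_bij 1 ax; exists v. Qed.

(** The norm of a section is defined by an arbitrary unit frame vector; E is
    the squared norm of the vector of the frame a at x, so the formula shows
    in particular that the choice does not matter. *)
Lemma sec_norm_sqr n (s : section L n) (a : tidx L) x (E : R) : tdom a x ->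
  (forall v, prj v = x -> nrm v ^+ 2 = modulus (triv a v) ^+ 2 * E) ->
  sec_norm nrm s x ^+ 2 = modulus (coef s a x) ^+ 2 * E ^+ n.
Proof.
move=> ax hE; rewrite /sec_norm.
set A := (X in get X).
have A0 : A !=set0.
  have [v vx v1] := frame_at a x ax.
  by exists (modulus (coef s a x) * nrm v ^+ n), a, v.
have [b [v [bx vx vb ->]]] := getPex A0.
have bv : tdom b (prj v) by rewrite vx.
have av : tdom a (prj v) by rewrite vx.
have := sec_glue s av bv; rewrite vb expr1n mulr1 vx => ->.
by rewrite modulusM modulusX !exprMn -!exprM mulnC exprM hE// exprMn -exprM mulrA.
Qed.

Lemma potentialE n (s : section L n) (a : tidx L) (phi : P -> R) x : (0 < n)%N ->
  (forall v, tdom a (prj v) ->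
     nrm v ^+ 2 = modulus (triv a v) ^+ 2 * expR (- phi (prj v))) ->
  tdom a x -> coef s a x != 0 ->
  potential nrm s x = phi x - n%:R^-1 * ln (modulus (coef s a x) ^+ 2).
Proof.
move=> n0 hphi ax c0; rewrite /potential.
rewrite (sec_norm_sqr n s a x (expR (- phi x)) ax); last first.
  by move=> v vx; rewrite hphi vx.
rewrite lnM ?posrE ?exprn_gt0 ?expR_gt0 ?modulus_gt0// (lnXn _ (expR_gt0 _)) expRK.
by rewrite -[_ *+ n]mulr_natr; field; rewrite pnatr_eq0 -lt0n.
Qed.

(** Locally the potential is a plurisubharmonic function minus 1/n times the
    logarithm of the squared modulus of a nonvanishing regular function. *)
Lemma potential_near (x : P) n (s : section L n) : hermitian_metric actL nrm ->
  (0 < n)%N -> nonvanishing s x ->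
  exists a (phi : P -> R), [/\ tdom a x, coef s a x != 0, smooth_spsh_on (tdom a) phi &
    forall y, tdom a y -> coef s a y != 0 ->
      potential nrm s y = phi y - n%:R^-1 * ln (modulus (coef s a y) ^+ 2)].
Proof.
move=> hm n0 [a ax ca]; have [phi sphi hphi] := nrm_smooth_positive hm a.
by exists a, phi; split=> // y ay cy; exact: potentialE.
Qed.

Lemma modulus_cexp_imag (x : R) : modulus (cexp ((x%:C)%C * 'i%C : C)) = 1.
Proof.
have -> : (x%:C)%C * 'i%C = (0 +i* x)%C :> C.
  by apply/eqP; rewrite eq_complex /=; apply/andP; split; apply/eqP; ring.
by rewrite /cexp modulusM modulus_real expR0 normr1 mul1r /modulus /= cos2Dsin2 sqrtr1.
Qed.

(** The compact torus preserves the metric, and multiplies the eigensection by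
    a number of modulus 1. *)
Lemma sec_norm_invariant n (s : section L n) (chi : 'rV[int]_r) (eta : 'rV[R]_r) x :
  algebraic_action X act -> linearization act actL -> hermitian_metric actL nrm ->
  eigensection act actL s chi -> X x ->
  let t := texp (map_mx (fun c : R => c%:C%C : C) eta) in
  torus t -> ctorus t ->
  sec_norm nrm s (act t x) ^+ 2 = sec_norm nrm s x ^+ 2.
Proof.
move=> aact lin hm eig Xx t tT tc.
have [a _ ax] := tdom_cover L Xx.
have [b _ bx] := tdom_cover L (act_stable aact tT Xx).
have [v vx v1] := frame_at a x ax.
have v'x : prj (actL t v) = act t x by rewrite (lin_covers lin)// vx.
have [phi _ hphi] := nrm_smooth_positive hm a.
have [psi _ hpsi] := nrm_smooth_positive hm b.
rewrite (sec_norm_sqr n s a x (expR (- phi x)) ax); last first.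
  by move=> w wx; rewrite hphi wx.
rewrite (sec_norm_sqr n s b (act t x) (expR (- psi (act t x))) bx); last first.
  by move=> w wx; rewrite hpsi wx.
have av : tdom a (prj v) by rewrite vx.
have bv : tdom b (act t (prj v)) by rewrite vx.
have := eig eta a b v av bv; rewrite -/t vx v1 expr1n mulr1.
move=> /(congr1 (@modulus R)); rewrite [modulus (cexp _ * _)]modulusM modulus_cexp_imag mul1r modulusM modulusX => <-.
have := nrm_invariant hm v tc; move=> /(congr1 (fun y => y ^+ 2)).
rewrite (hphi v av) hpsi ?v'x// v1 modulus1 expr1n mul1r vx => <-.
by rewrite !exprMn -!exprM mulnC mulrA -exprD addnn mul2n.
Qed.

End SectionNorm.

(** * The exponential of the torus and the curves it draws *)

Section TorusCurves.
Context {R : realType} {r : nat}.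
Local Notation C := (Cx R).
Local Notation TT := 'rV[C]_r.

Definition cvec (eta : 'rV[R]_r) : TT := map_mx (fun c : R => c%:C%C : C) eta.

Lemma cexpD (z w : C) : cexp (z + w) = cexp z * cexp w.
Proof.
case: z w => a b [c d]; rewrite /cexp; apply/eqP; rewrite eq_complex /= expRD cosD sinD.
by apply/andP; split; apply/eqP; ring.
Qed.

Lemma modulus_cexp (z : C) : modulus (cexp z) = expR (Re z).
Proof.
rewrite /cexp modulusM modulus_real (ger0_norm (expR_ge0 _)).
by rewrite /modulus /= cos2Dsin2 sqrtr1 mulr1.
Qed.

Lemma texpD (z w : TT) : texp (z + w) = tmul (texp z) (texp w).
Proof. by apply/rowP => j; rewrite !mxE mulrDr cexpD. Qed.

Lemma texp_torus (z : TT) : torus (texp z).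
Proof. by move=> j; rewrite mxE -modulus_gt0 modulus_cexp expR_gt0. Qed.

Lemma texp0 : texp (0 : TT) = tone R r.
Proof.
apply/rowP => j; rewrite !mxE mulr0 /cexp /= expR0 cos0 sin0 mul1r.
by apply/eqP; rewrite eq_complex /= !eqxx.
Qed.

Lemma texp_ctorus (eta : 'rV[R]_r) : ctorus (texp (cvec eta)).
Proof.
move=> j; rewrite !mxE modulus_cexp -(expR0 R); congr expR.
by rewrite /=; ring.
Qed.

Lemma polar (z : C) : z != 0 ->
  exists t : R, z = ((modulus z)%:C%C : C) * (cos t +i* sin t)%C.
Proof.
move=> z0; have m0 : 0 < modulus z by rewrite modulus_gt0.
case: z z0 m0 => a b z0 m0; set m := modulus _ in m0 *.
have m2 : m ^+ 2 = a ^+ 2 + b ^+ 2 by rewrite /m /modulus /= sqr_sqrtr// addr_ge0// sqr_ge0.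
have am : -1 <= a / m <= 1.
  by rewrite -ler_norml normrM normfV (gtr0_norm m0) ler_pdivrMr// mul1r (modulus_Re (a +i* b)%C).
have sn : Num.sqrt (1 - (a / m) ^+ 2) = `|b| / m.
  have -> : 1 - (a / m) ^+ 2 = (b / m) ^+ 2.
    rewrite !exprMn !exprVn m2; field; rewrite -m2; exact: expf_neq0 (lt0r_neq0 m0).
  by rewrite sqrtr_sqr normrM normfV (gtr0_norm m0).
have ac : cos (acos (a / m)) = a / m by apply: acosK; rewrite in_itv.
have ma : m * (a / m) = a by rewrite mulrC divfK// gt_eqF.
have mb : m * (b / m) = b by rewrite mulrC divfK// gt_eqF.
have [b0|b0] := leP 0 b.
  exists (acos (a / m)); apply/eqP; rewrite eq_complex /= ac (sin_acos am) sn.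
  by rewrite (ger0_norm b0) !mul0r subr0 addr0 ma mb !eqxx.
exists (- acos (a / m)); apply/eqP; rewrite eq_complex /= cosN sinN ac (sin_acos am) sn.
by rewrite (ltr0_norm b0) mulNr opprK !mul0r subr0 addr0 ma mb !eqxx.
Qed.

(** The splitting of the complex torus into its compact part and the
    noncompact directions exp(i b). *)
Lemma torus_polar (t : TT) : torus t -> exists a b : 'rV[R]_r,
  t = texp (cvec a + 'i%C *: cvec b) /\
  forall j, modulus (t 0 j) = expR (- (2 * pi * b 0 j)).
Proof.
move=> tT; have : forall j, exists x : R, t 0 j =
    ((modulus (t 0 j))%:C%C : C) * (cos x +i* sin x)%C by move=> j; exact: polar.
move=> /boolp.choice[x hx].
have pi0 : (pi : R) != 0 by rewrite gt_eqF// pi_gt0.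
exists (\row_j (x j / (2 * pi))), (\row_j (- ln (modulus (t 0 j)) / (2 * pi))).
have cancel (y : R) : 2 * pi * (y / (2 * pi)) = y.
  by rewrite mulrC divfK// mulf_neq0.
have mt j : modulus (t 0 j) =
    expR (- (2 * pi * (- ln (modulus (t 0 j)) / (2 * pi)))).
  by rewrite cancel opprK lnK// posrE modulus_gt0.
split; last by move=> j; rewrite !mxE; exact: mt.
apply/rowP => j; rewrite {1}hx !mxE /cexp.
have := mt j; move: (- ln _) => l mtj.
have -> : ((2 * pi)%:C%C : C) * 'i%C * ((x j / (2 * pi))%:C%C + 'i%C * (l / (2 * pi))%:C%C)
   = (- l +i* x j)%C.
  rewrite -[in RHS](cancel l) -[in RHS](cancel (x j)).
  move: (2 * pi) (l / _) (x j / _) => k p q.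
  by apply/eqP; rewrite eq_complex /=; apply/andP; split; apply/eqP; ring.
by rewrite mtj cancel.
Qed.

Lemma ctorus_polar (t : TT) : ctorus t -> exists a : 'rV[R]_r, t = texp (cvec a).
Proof.
move=> tc; have tT : torus t by move=> j; rewrite -modulus_gt0 (tc j).
have [a [b [tE bE]]] := torus_polar t tT; exists a; rewrite tE; congr texp.
rewrite (_ : b = 0); first by rewrite /cvec map_mx0 scaler0 addr0.
apply/rowP => j; rewrite mxE; have := bE j; rewrite (tc j) -(expR0 R) => /expR_inj/esym/eqP.
by rewrite oppr_eq0 mulf_eq0 (gt_eqF _) ?mulr_gt0 ?pi_gt0//= => /eqP.
Qed.

End TorusCurves.

Section ActionCurves.
Context {R : realType} {N r : nat}.
Local Notation C := (Cx R).
Local Notation P := (proj_space R N).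
Local Notation W := 'rV[C]_N.+1.
Local Notation TT := 'rV[C]_r.
Implicit Types (X U : set P) (act : TT -> P -> P) (x y : P).

Lemma jet_meval n (f : 'I_n -> C -> C) (p : mpoly n C) : (forall j, jet (f j)) ->
  jet (fun w => meval (f^~ w) p).
Proof.
move=> jf; under eq_fun do rewrite mevalE.
apply: jet_sum => m; apply: jetM; first exact: jet_cst.
by apply: jet_prod => j; exact: jetX.
Qed.

Lemma evTE (p : mpoly N.+1 (mpoly r C)) (t : TT) x :
  evT p t x = \sum_(m <- msupp p) meval (fun j => t 0 j) (mcoeff m p) *
                \prod_i hcoord x 0 i ^+ m i.
Proof.
rewrite /evT /map_mpoly /mmap raddf_sum; apply: eq_bigr => m _.
by etransitivity; [exact: mevalM|rewrite mevalC mmap1_id mevalX].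
Qed.

Lemma jet_texp (eta : 'rV[R]_r) j : jet (fun w : C => texp (w *: cvec eta) 0 j).
Proof.
have := jet_cexp (2 * pi * eta 0 j); apply: eq_jet; near=> w.
rewrite !mxE; congr cexp; rewrite realCM; ring.
Unshelve. all: by end_near.
Qed.

(** By algebraicity, homogeneous coordinates of exp(w eta).y are polynomials in
    exponentials of multiples of w. *)
Lemma action_curve X act y (eta : 'rV[R]_r) : algebraic_action X act -> X y ->
  exists Q : C -> W, [/\ forall j, jet (fun w => Q w 0 j), Q 0 != 0 &
    \forall w \near axes0, Q w != 0 /\ act (texp (w *: cvec eta)) y = pt (Q w)].
Proof.
move=> aact Xy.
have t1 : torus (tone R r) by move=> j; rewrite mxE oner_neq0.
have [d [F [hF [j0 Fj0] actF]]] := act_regular aact t1 Xy.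
pose Q (w : C) : W := \row_j evT (F j) (texp (w *: cvec eta)) y.
have jQ j : jet (fun w => Q w 0 j).
  under eq_fun do rewrite mxE evTE.
  apply: jet_sum => m; apply: jetM; last exact: jet_cst.
  by apply: jet_meval => i; exact: jet_texp.
have Q0 : Q 0 0 j0 != 0 by rewrite mxE scale0r texp0.
exists Q; split=> //; first exact: coord_neq0 Q0.
near=> w.
have Qw : Q w 0 j0 != 0 by near: w; exact: jet_neq0.
split; first exact: coord_neq0 Qw.
rewrite actF//; first exact: texp_torus.
by exists j0; move: Qw; rewrite mxE.
Unshelve. all: by end_near.
Qed.

Lemma curve_near (Q : C -> W) (O : set P) : (forall j, jet (fun w => Q w 0 j)) ->
  Q 0 != 0 -> nbhs (pt (Q 0)) O -> \forall w \near axes0, O (pt (Q w)).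
Proof.
move=> jQ Q0; rewrite nbhsE => -[B [oB BQ] BO].
have /nbhs_rVP[d d0 hd] := near_pt (Q 0) B Q0 oB BQ.
have H j : \forall w \near axes0, modulus (Q w 0 j - Q 0 0 j) < d.
  exact: (jet_near (fun w => Q w 0 j)).
have H' := @filter_forall C 'I_N.+1 (fun j w => modulus (Q w 0 j - Q 0 0 j) < d)
  axes0 axes0_filter H.
by apply: (filterS _ H') => w /hd[_ /BO].
Qed.

Lemma action_curve_near X act (eta : 'rV[R]_r) y (O : set P) :
  algebraic_action X act -> X y -> nbhs y O ->
  \forall w \near axes0, O (act (texp (w *: cvec eta)) y).
Proof.
move=> aact Xy yO; have [Q [jQ Q0 hQ]] := action_curve X act y eta aact Xy.
have yE : y = pt (Q 0).
  by have [_ <-] := axes0_at0 _ hQ; rewrite scale0r texp0 (act_one aact).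
rewrite yE in yO; have hO := curve_near Q O jQ Q0 yO.
near=> w; have [_ ->] : Q w != 0 /\ act (texp (w *: cvec eta)) y = pt (Q w) by near: w.
by near: w.
Unshelve. all: by end_near.
Qed.

End ActionCurves.

(** * Potentials along orbits of the torus *)

Section PotentialAlongOrbits.
Context {R : realType} {N r : nat}.
Local Notation C := (Cx R).
Local Notation P := (proj_space R N).
Local Notation W := 'rV[C]_N.+1.
Local Notation V := 'rV[C]_N.
Local Notation TT := 'rV[C]_r.
Implicit Types (X U : set P) (act : TT -> P -> P) (x y : P).

Lemma eq_sum4_near (f g : C -> R) : (\forall w \near axes0, f w = g w) ->
  \forall e \near (0 : R)^'+, sum4 f e = sum4 g e.
Proof.
by move=> /near_four_points; apply: filterS => e [e1 e2 e3 e4]; rewrite /sum4 e1 e2 e3 e4.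
Qed.

(** [spsh_submean] in an affine chart around the point. *)
Lemma spsh_curve_submean U (phi : P -> R) (Q : C -> W) (k : R) :
  smooth_spsh_on U phi -> (forall j, jet (fun w => Q w 0 j)) -> Q 0 != 0 ->
  (\forall w \near axes0, U (pt (Q w))) -> 0 < k ->
  \forall e \near (0 : R)^'+,
    4 * phi (pt (Q 0)) - k * e ^+ 2 <= sum4 (fun w => phi (pt (Q w))) e.
Proof.
move=> sphi jQ Q0 UQ k0; have [l Ql] := nonzero_coord _ Q0.
pose c (w : C) : V := affine l (Q w).
have jc i : jet (fun w => c w 0 i).
  under eq_fun do rewrite mxE.
  by apply: jetM => //; apply: jetV.
have U0 := axes0_at0 _ UQ.
have Qc0 : pt (Q 0) = chart l (c 0) by exact: pt_chart.
have [Om [u [oOm Oc [su psh] uphi]]] := sphi l (c 0) (eq_ind _ U U0 _ Qc0).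
have nOm : nbhs (c 0) Om by exact: open_nbhs_nbhs.
have /nbhs_rVP[d d0 hd] := nOm.
have nOmc : \forall w \near axes0, Om (c w).
  have H := @filter_forall C 'I_N (fun i w => modulus (c w 0 i - c 0 0 i) < d)
    axes0 axes0_filter (fun i => jet_near (fun w => c w 0 i) d (jc i) d0).
  by apply: (filterS _ H) => w /hd.
have E : \forall w \near axes0, u (c w) = phi (pt (Q w)).
  near=> w.
  have Qw : Q w 0 l != 0 by near: w; exact: jet_neq0.
  rewrite (pt_chart l _ Qw); apply: uphi; first by near: w.
  by rewrite -pt_chart//; near: w.
have S := spsh_submean Om u c k oOm su psh jc Oc k0.
have E4 := eq_sum4_near _ _ E.
have E0 : u (c 0) = phi (pt (Q 0)) by exact: (axes0_at0 _ E).
near=> e; rewrite -E0.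
have <- : sum4 (fun w => u (c w)) e = sum4 (fun w => phi (pt (Q w))) e by near: e.
by near: e.
Unshelve. all: by end_near.
Qed.

Lemma log_regular_curve_mean U (g : P -> C) (Q : C -> W) (k : R) :
  regular_on U g -> (forall j, jet (fun w => Q w 0 j)) -> Q 0 != 0 ->
  (\forall w \near axes0, Q w != 0 /\ U (pt (Q w))) -> g (pt (Q 0)) != 0 -> 0 < k ->
  \forall e \near (0 : R)^'+,
    sum4 (fun w => ln (modulus (g (pt (Q w))) ^+ 2)) e <=
    4 * ln (modulus (g (pt (Q 0))) ^+ 2) + k * e ^+ 2.
Proof.
move=> gU jQ Q0 UQ g0 k0.
have [_ U0] := axes0_at0 _ UQ.
have [d [p [q [hp hq qx gE]]]] := gU _ U0.
pose ph (w : C) : C := meval (fun j => Q w 0 j) p.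
pose qh (w : C) : C := meval (fun j => Q w 0 j) q.
have jp : jet ph by exact: (jet_meval N.+1 (fun j w => Q w 0 j)).
have jq : jet qh by exact: (jet_meval N.+1 (fun j w => Q w 0 j)).
have q0 : qh 0 != 0 by rewrite /qh -(ev_pt_neq0 d q (Q 0) hq Q0).
have E : \forall w \near axes0, ph w / qh w = g (pt (Q w)).
  near=> w.
  have [Qw Uw] : Q w != 0 /\ U (pt (Q w)) by near: w.
  have qw : qh w != 0 by near: w; exact: jet_neq0.
  rewrite (gE _ Uw); first by rewrite (ev_pt_ratio d p q _ hp hq Qw).
  by rewrite (ev_pt_neq0 d q _ hq Qw).
have E0 := axes0_at0 _ E.
have jr : jet (fun w => ph w / qh w) by apply: jetM => //; exact: jetV.
have r0 : ph 0 / qh 0 != 0 by rewrite E0.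
have S := log_modulus_mean _ k jr r0 k0.
have E4 : \forall e \near (0 : R)^'+,
    sum4 (fun w => ln (modulus (ph w / qh w) ^+ 2)) e =
    sum4 (fun w => ln (modulus (g (pt (Q w))) ^+ 2)) e.
  by apply: eq_sum4_near; apply: filterS E => w ->.
rewrite -E0; near=> e.
have <- : sum4 (fun w => ln (modulus (ph w / qh w) ^+ 2)) e =
    sum4 (fun w => ln (modulus (g (pt (Q w))) ^+ 2)) e by near: e.
by near: e.
Unshelve. all: by end_near.
Qed.

End PotentialAlongOrbits.

Section PotentialRegularity.
Context {R : realType} {N r : nat} {X : set (proj_space R N)}.
Local Notation C := (Cx R).
Local Notation P := (proj_space R N).
Local Notation TT := 'rV[C]_r.
Context (L : line_bundle X) (nrm : tot L -> R).
Context (act : TT -> P -> P) (actL : TT -> tot L -> tot L).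
Context (hm : hermitian_metric actL nrm).
Implicit Types (x y : P).

Lemma near_regular_neq0 (U : set P) (g : P -> C) x : regular_on U g -> U x ->
  g x != 0 -> \forall y \near x, U y -> g y != 0.
Proof.
move=> gU Ux g0; apply: (regular_cvg U g x gU Ux [set w : C | w != 0]).
apply/nbhs_CxP; exists (modulus (g x)); first by rewrite modulus_gt0.
by move=> w; apply: contraTneq => ->; rewrite sub0r modulusN ltxx.
Qed.

Lemma near_nonvanishing (a : tidx L) n (s : section L n) x :
  tdom a x -> coef s a x != 0 ->
  \forall y \near x, X y -> tdom a y /\ coef s a y != 0.
Proof.
move=> ax c0; have H1 := near_zopen X (tdom a) x (tdom_open a) ax.
have H2 := near_regular_neq0 (tdom a) _ x (@coef_regular _ _ _ _ _ s a) ax c0.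
near=> y => Xy.
have ay : tdom a y by move: Xy; near: y; exact: H1.
by split=> //; move: ay; near: y; exact: H2.
Unshelve. all: by end_near.
Qed.

(** The two terms of [potential_near] are handled by [spsh_curve_submean] and
    [log_regular_curve_mean]; the factor 1/n is harmless as it is at most 1. *)
Lemma potential_submean n (s : section L n) y (eta : 'rV[R]_r) (k : R) :
  algebraic_action X act -> (0 < n)%N -> X y -> nonvanishing s y -> 0 < k ->
  \forall e \near (0 : R)^'+, 4 * potential nrm s y - k * e ^+ 2 <=
    sum4 (fun w => potential nrm s (act (texp (w *: cvec eta)) y)) e.
Proof.
move=> aact n0 Xy sy k0.
have [a [phi [ay cy sphi pE]]] := potential_near L nrm actL y n s hm n0 sy.
have [Q [jQ Q0 hQ]] := action_curve X act y eta aact Xy.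
have yE : y = pt (Q 0).
  by have [_ <-] := axes0_at0 _ hQ; rewrite scale0r texp0 (act_one aact).
have good : \forall w \near axes0, tdom a (pt (Q w)) /\ coef s a (pt (Q w)) != 0.
  have H := action_curve_near X act eta y _ aact Xy (near_nonvanishing a n s y ay cy).
  near=> w.
  have [_ <-] : Q w != 0 /\ act (texp (w *: cvec eta)) y = pt (Q w) by near: w.
  have Xw := act_stable aact (texp_torus (w *: cvec eta)) Xy.
  by move: Xw; near: w.
have Qgood : \forall w \near axes0, Q w != 0 /\ tdom a (pt (Q w)).
  near=> w; split.
    by have [] : Q w != 0 /\ act (texp (w *: cvec eta)) y = pt (Q w) by near: w.
  by have [] : tdom a (pt (Q w)) /\ coef s a (pt (Q w)) != 0 by near: w.
have Ugood : \forall w \near axes0, tdom a (pt (Q w)).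
  by apply: filterS Qgood => w [].
have k2 : 0 < k / 2 by exact: divr_gt0.
have S1 := spsh_curve_submean (tdom a) phi Q (k / 2) sphi jQ Q0 Ugood k2.
rewrite yE in cy.
have S2 := log_regular_curve_mean (tdom a) _ Q (k / 2) (@coef_regular _ _ _ _ _ s a) jQ Q0 Qgood cy k2.
have E : \forall w \near axes0, potential nrm s (act (texp (w *: cvec eta)) y) =
    phi (pt (Q w)) - n%:R^-1 * ln (modulus (coef s a (pt (Q w))) ^+ 2).
  near=> w.
  have [_ ->] : Q w != 0 /\ act (texp (w *: cvec eta)) y = pt (Q w) by near: w.
  have [aw cw] : tdom a (pt (Q w)) /\ coef s a (pt (Q w)) != 0 by near: w.
  exact: pE.
have E4 := eq_sum4_near _ _ E.
have E0 : potential nrm s y =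
    phi (pt (Q 0)) - n%:R^-1 * ln (modulus (coef s a (pt (Q 0))) ^+ 2).
  by rewrite {1}yE; apply: pE => //; rewrite -yE.
near=> e.
have -> : sum4 (fun w => potential nrm s (act (texp (w *: cvec eta)) y)) e =
  sum4 (fun w => phi (pt (Q w)) - n%:R^-1 * ln (modulus (coef s a (pt (Q w))) ^+ 2)) e.
  by near: e.
have T1 : 4 * phi (pt (Q 0)) - k / 2 * e ^+ 2 <= sum4 (fun w => phi (pt (Q w))) e.
  by near: e.
have T2 : sum4 (fun w => ln (modulus (coef s a (pt (Q w))) ^+ 2)) e <=
    4 * ln (modulus (coef s a (pt (Q 0))) ^+ 2) + k / 2 * e ^+ 2 by near: e.
have m0 : 0 <= n%:R^-1 :> R by rewrite invr_ge0 ler0n.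
have m1 : n%:R^-1 <= 1 :> R by rewrite invf_le1 ?ltr0n// ler1n.
have e2 : 0 <= e ^+ 2 by exact: sqr_ge0.
rewrite E0; move: T1 T2 e2; rewrite /sum4; cbv beta.
move: m0 m1; move: (n%:R^-1) (e ^+ 2) (phi _) (phi _) (phi _) (phi _) (phi _) (ln _) (ln _) (ln _) (ln _) (ln _).
move=> m E2 p1 p2 p3 p4 p5 l1 l2 l3 l4 l5 m0 m1 T1 T2 e2.
have := ler_wpM2l m0 T2.
have : m * (k / 2 * E2) <= k / 2 * E2.
  by rewrite ler_piMl// mulr_ge0// ltW.
lra.
Unshelve. all: by end_near.
Qed.

Lemma potential_cvg n (s : section L n) y : (0 < n)%N -> X y -> nonvanishing s y ->
  potential nrm s @ within X (nbhs y) --> potential nrm s y.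
Proof.
move=> n0 Xy sy.
have [a [phi [ay cy sphi pE]]] := potential_near L nrm actL y n s hm n0 sy.
have cphi : phi @ within (tdom a) (nbhs y) --> phi y.
  apply: (locally_extends_cvg (tdom a) _ phi y _ sphi ay) => Om F [sF _] b Ob.
  by have [cF _] := sF 0%N; exact: cF.
have cc := regular_cvg (tdom a) _ y (@coef_regular _ _ _ _ _ s a) ay.
have cm : (fun x => modulus (coef s a x)) @ within (tdom a) (nbhs y) -->
    modulus (coef s a y).
  apply/cvgrPdist_lt => e e0.
  have nC : nbhs (coef s a y) [set w : C | modulus (w - coef s a y) < e].
    by apply/nbhs_CxP; exists e.
  have cc' : \forall x \near y, tdom a x -> modulus (coef s a x - coef s a y) < e.
    exact: cc _ nC.
  rewrite near_withinE; near=> x => ax.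
  apply: (@le_lt_trans _ _ (modulus (coef s a x - coef s a y))); last first.
    by move: ax; near: x.
  by rewrite distrC modulus_dist.
have cl : (fun x => phi x - n%:R^-1 * ln (modulus (coef s a x) ^+ 2))
    @ within (tdom a) (nbhs y) -->
    phi y - n%:R^-1 * ln (modulus (coef s a y) ^+ 2).
  apply: cvgB => //; apply: cvgM; first exact: cvg_cst.
  have cln : {for modulus (coef s a y), continuous (fun t : R => ln (t ^+ 2))}.
    apply: continuous_comp; first exact: exprn_continuous.
    by apply: continuous_ln; rewrite exprn_gt0// modulus_gt0.
  exact: (cvg_comp _ _ cm cln).
have near_good := near_nonvanishing a n s y ay cy.
rewrite pE//; apply/cvgrPdist_lt => e e0; rewrite near_withinE.
move/cvgrPdist_lt: cl => /(_ e e0); rewrite near_withinE => cl.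
near=> x => Xx.
have [ax cx] : tdom a x /\ coef s a x != 0 by move: Xx; near: x.
by rewrite pE//; move: ax; near: x.
Unshelve. all: by end_near.
Qed.

End PotentialRegularity.

(** * Convexity along the noncompact directions *)

Section QuasiConvexity.
Context {R : realType}.

(** If g(t) exceeded both endpoint values, so would g + k t^2 for a small
    k > 0; at an interior maximum of the latter the second difference of g
    would be at most -2 k e^2. *)
Lemma max_at_endpoint (g : R -> R) : continuous g ->
  (forall t k : R, 0 < k ->
     \forall e \near (0 : R)^'+, 2 * g t - k * e ^+ 2 <= g (t + e) + g (t - e)) ->
  forall t, 0 <= t <= 1 -> g t <= Num.max (g 0) (g 1).
Proof.
move=> cg conv t /andP[t0 t1]; rewrite leNgt; apply/negP => gt_max.
set m := Num.max _ _ in gt_max.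
have m0 : g 0 <= m by rewrite le_max lexx.
have m1 : g 1 <= m by rewrite le_max lexx orbT.
pose k := (g t - m) / 2; have k0 : 0 < k by rewrite /k; lra.
pose h s := g s + k * s ^+ 2.
have ch : {within `[0, 1], continuous h}.
  apply: continuous_subspaceT => s; apply: cvgD; first exact: cg.
  apply: cvgM; first exact: cvg_cst.
  exact: exprn_continuous.
have [c c01 hc] := EVT_max ler01 ch.
move: c01; rewrite in_itv/= => /andP[c0 c1].
have ht : h t <= h c by apply: hc; rewrite in_itv/= t0.
have hge : m + 2 * k <= h t.
  have : 0 <= k * t ^+ 2 by rewrite mulr_ge0 ?sqr_ge0// ltW.
  by rewrite /h /k; lra.
have c0' : 0 < c.
  rewrite lt_def c0 andbT; apply/eqP => cE; move: ht; rewrite cE {2}/h expr0n/= mulr0.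
  lra.
have c1' : c < 1.
  rewrite lt_def c1 andbT; apply/eqP => cE; move: ht; rewrite -cE {2}/h expr1n mulr1.
  lra.
have cc := conv c k k0.
near ((0 : R)^'+) => e.
have e0 : 0 < e by [].
have ec : e < c by near: e; exact: nbhs_right_lt.
have ec1 : e < 1 - c by near: e; apply: nbhs_right_lt; rewrite subr_gt0.
have h1 : h (c + e) <= h c by apply: hc; rewrite in_itv/=; apply/andP; split; lra.
have h2 : h (c - e) <= h c by apply: hc; rewrite in_itv/=; apply/andP; split; lra.
have h3 : 2 * g c - k * e ^+ 2 <= g (c + e) + g (c - e) by near: e.
have : 0 < k * e ^+ 2 by rewrite mulr_gt0// exprn_gt0.
move: h1 h2 h3; rewrite /h; move: (g (c + e)) (g (c - e)) (g c) => x1 x2 x3.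
rewrite sqrrD sqrrB; lra.
Unshelve. all: by end_near.
Qed.

End QuasiConvexity.

Section OrbitPaths.
Context {R : realType} {N r : nat} {X : set (proj_space R N)}.
Local Notation C := (Cx R).
Local Notation P := (proj_space R N).
Local Notation TT := 'rV[C]_r.
Context (act : TT -> P -> P).
Context (aact : algebraic_action X act).
Implicit Types (x y : P) (eta : 'rV[R]_r).

(** The curve t |-> exp(i t eta).x, along which the potentials are convex. *)
Definition orbit_path eta x (t : R) : P := act (texp (('i%C * (t%:C)%C : C) *: cvec eta)) x.

Lemma orbit_path0 eta x : X x -> orbit_path eta x 0 = x.
Proof.
move=> Xx; have i0 : ('i%C * ((0 : R)%:C)%C : C) = 0.
  by apply/eqP; rewrite eq_complex /= !mulr0 subr0 addr0 eqxx.
rewrite /orbit_path i0 scale0r texp0; exact: (act_one aact).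
Qed.

Lemma orbit_path_in eta x t : X x -> X (orbit_path eta x t).
Proof. by move=> Xx; apply: (act_stable aact) => //; exact: texp_torus. Qed.

Lemma orbit_pathD eta x t s : X x ->
  orbit_path eta x (t + s) = orbit_path eta (orbit_path eta x t) s.
Proof.
move=> Xx.
have E : texp (('i%C * ((t + s)%:C)%C : C) *: cvec eta) =
    tmul (texp (('i%C * (s%:C)%C : C) *: cvec eta)) (texp (('i%C * (t%:C)%C : C) *: cvec eta)).
  by rewrite -texpD -scalerDl -mulrDr -realCD addrC.
by rewrite /orbit_path E; apply: (act_mul aact) => //; exact: texp_torus.
Qed.

Lemma orbit_path_continuous (f : P -> R) (U : set P) eta x : X x ->
  (forall t, U (orbit_path eta x t)) ->
  (forall y, U y -> f @ within U (nbhs y) --> f y) ->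
  continuous (fun t => f (orbit_path eta x t)).
Proof.
move=> Xx Ux fU t; apply/cvgrPdist_lt => e e0.
pose y := orbit_path eta x t.
have Xy : X y by exact: orbit_path_in.
have H : \forall z \near y, U z -> `|f y - f z| < e.
  by have /cvgrPdist_lt /(_ e e0) := fU y (Ux t); rewrite near_withinE.
have /axes0P[d d0 hd] := action_curve_near X act eta y _ aact Xy H.
apply/nbhs_ballP; exists d => // s; rewrite /ball /= => st.
have -> : s = t + (s - t) by rewrite addrC subrK.
rewrite orbit_pathD//; apply: hd.
- by left; rewrite /= mul0r mulr0 subr0.
- by rewrite modulusM modulus_i mul1r modulus_real distrC.
- have := Ux (t + (s - t)); rewrite orbit_pathD//.
Qed.

End OrbitPaths.

Section PotentialOnOrbits.
Context {R : realType} {N r : nat} {X : set (proj_space R N)}.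
Local Notation C := (Cx R).
Local Notation P := (proj_space R N).
Local Notation TT := 'rV[C]_r.
Context (L : line_bundle X) (nrm : tot L -> R).
Context (act : TT -> P -> P) (actL : TT -> tot L -> tot L).
Context (aact : algebraic_action X act).
Context (lin : linearization act actL).
Context (hm : hermitian_metric actL nrm).
Context (n : nat) (s : section L n) (chi : 'rV[int]_r).
Context (eig : eigensection act actL s chi).

Lemma potential_invariant (t : TT) (x : P) : ctorus t -> X x ->
  potential nrm s (act t x) = potential nrm s x.
Proof.
move=> tc Xx; have [eta tE] := ctorus_polar t tc.
rewrite /potential tE (sec_norm_invariant L nrm act actL n s chi eta x)//.
  exact: texp_torus.
exact: texp_ctorus.
Qed.

(** Of the four points in [potential_submean], the two real ones have the value
    of the center because the compact torus preserves the potential; what is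
    left is a second difference along the path. *)
Lemma potential_max_at_endpoint (eta : 'rV[R]_r) (x : P) (t : R) : (0 < n)%N -> X x ->
  (forall u, nonvanishing s (orbit_path act eta x u)) -> 0 <= t <= 1 ->
  potential nrm s (orbit_path act eta x t) <=
  Num.max (potential nrm s (orbit_path act eta x 0))
          (potential nrm s (orbit_path act eta x 1)).
Proof.
move=> n0 Xx sx; apply: (max_at_endpoint (fun u => potential nrm s (orbit_path act eta x u))).
  apply: (orbit_path_continuous act aact (potential nrm s)
    [set y | X y /\ nonvanishing s y] eta x Xx) => [u|y [Xy sy]].
    by split; [exact: orbit_path_in|exact: sx].
  have c := potential_cvg L nrm actL hm n s y n0 Xy sy; move=> B By.
  have H : \forall z \near y, X z -> B (potential nrm s z) := c B By.
  have H' : \forall z \near y, (X z /\ nonvanishing s z) -> B (potential nrm s z).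
    by near=> z => -[Xz _]; move: Xz; near: z; exact: H.
  exact: H'.
move=> u k k0; pose y := orbit_path act eta x u.
have Xy : X y := orbit_path_in act aact eta x u Xx.
have S := potential_submean L nrm act actL hm n s y eta k aact n0 Xy (sx u) k0.
have real_dir (e : R) : potential nrm s (act (texp ((e%:C)%C *: cvec eta)) y) = potential nrm s y.
  have -> : (e%:C)%C *: cvec eta = cvec (e *: eta).
    by apply/rowP => j; rewrite !mxE realCM.
  by apply: potential_invariant => //; exact: texp_ctorus.
near=> e.
have : 4 * potential nrm s y - k * e ^+ 2 <=
    sum4 (fun w => potential nrm s (act (texp (w *: cvec eta)) y)) e by near: e.
have -> : sum4 (fun w => potential nrm s (act (texp (w *: cvec eta)) y)) e =
    potential nrm s y + potential nrm s y +
    potential nrm s (orbit_path act eta y e) +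
    potential nrm s (orbit_path act eta y (- e)).
  by rewrite /sum4; congr (_ + _ + _ + _); exact: real_dir.
rewrite /y -(orbit_pathD act aact eta x u e Xx) -(orbit_pathD act aact eta x u (- e) Xx).
have drop (p a b c : R) : 4 * p - a <= p + p + b + c -> 2 * p - a <= b + c by lra.
exact: drop.
Unshelve. all: by end_near.
Qed.

End PotentialOnOrbits.

(** * Orbits and fibers of the quotient *)

Section OrbitsAndFibers.
Context {R : realType} {N r : nat} {X : set (proj_space R N)}.
Local Notation C := (Cx R).
Local Notation P := (proj_space R N).
Local Notation TT := 'rV[C]_r.
Context (act : TT -> P -> P) (mu : P -> 'rV[R]_r) (xi : 'rV[R]_r).
Context (aact : algebraic_action X act).
Context (Y : topologicalType) (q : P -> Y) (OY : set Y -> set (Y -> C)).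
Context (hq : hilbert_quotient X act mu xi q OY).
Implicit Types (x y z : P) (t : TT).

Lemma tone_torus : torus (tone R r).
Proof. by move=> j; rewrite mxE oner_neq0. Qed.

Lemma orbit_refl x : X x -> Defs.orbit act x x.
Proof. by move=> Xx; exists (tone R r); [exact: tone_torus|exact: (act_one aact)]. Qed.

Lemma orbit_act x t : X x -> torus t -> Defs.orbit act (act t x) = Defs.orbit act x.
Proof.
move=> Xx tT.
have mulT s s' : torus s -> torus s' -> torus (tmul s s').
  by move=> sT sT' j; rewrite mxE mulf_neq0.
pose t' : TT := \row_j (t 0 j)^-1.
have t'T : torus t' by move=> j; rewrite mxE invr_eq0.
have tt' : tmul t' t = tone R r by apply/rowP => j; rewrite !mxE mulVf.
apply/seteqP; split=> y [s sT <-].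
  by exists (tmul s t); [exact: mulT|rewrite (act_mul aact)].
exists (tmul s t'); first exact: mulT.
rewrite (act_mul aact)//; last exact: (act_stable aact).
by rewrite -(act_mul aact t'T tT Xx) tt' (act_one aact).
Qed.

Lemma semistable_act x t : torus t -> semistable X act mu xi x ->
  semistable X act mu xi (act t x).
Proof.
by move=> tT [Xx h]; split; [exact: (act_stable aact)|rewrite orbit_act].
Qed.

Lemma mu_fiber_semistable z : mu_fiber X mu xi z -> semistable X act mu xi z.
Proof.
move=> zmu; have Xz : X z by case: zmu.
split=> //; exists z; split=> //; apply: subset_closure; exact: orbit_refl.
Qed.

Lemma quotient_act x t : torus t -> semistable X act mu xi x -> q (act t x) = q x.
Proof.
move=> tT xss; have Xx : X x by case: xss.
apply/(hq_fibers hq); [exact: semistable_act|by []|].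
exists x; split=> //; rewrite orbit_act// setIid.
by apply: subset_closure; exact: orbit_refl.
Qed.

(** The orbit of a semistable point degenerates to a point of mu^-1(xi), which
    lies in the same fiber of the quotient since it is in both closures. *)
Lemma semistable_limit x : semistable X act mu xi x ->
  exists z, [/\ mu_fiber X mu xi z, closure (Defs.orbit act x) z & q z = q x].
Proof.
move=> xss; have [Xx [z [xz zmu]]] := xss; exists z; split=> //.
have zss := mu_fiber_semistable z zmu.
apply/(hq_fibers hq) => //; exists z; split=> //; split=> //.
by apply: subset_closure; apply: orbit_refl; case: zmu.
Qed.

(** The set whose element [reduced] picks is a single value, as each fiber meets
    mu^-1(xi) in one orbit of the compact torus. *)
Lemma reducedE (D : set P) (u : P -> R) z :
  (forall t x, ctorus t -> D x -> u (act t x) = u x) ->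
  (forall x, semistable X act mu xi x -> q x = q z -> D x) ->
  mu_fiber X mu xi z ->
  reduced X act mu xi q u (q z) = u z.
Proof.
move=> uinv Dz zmu.
have [x0 x0mu E] := hq_zero_fiber hq (q z).
have x0q : q x0 = q z.
  have : (semistable X act mu xi `&` q @^-1` [set q z] `&` mu_fiber X mu xi) x0.
    rewrite E; exists (tone R r); first by move=> j; rewrite mxE modulus1.
    by apply: (act_one aact); case: x0mu.
  by case=> [[_ ->]].
have Dx0 : D x0 by apply: Dz => //; exact: mu_fiber_semistable.
have const y : mu_fiber X mu xi y -> q y = q z -> u y = u x0.
  move=> ymu yq.
  have : (semistable X act mu xi `&` q @^-1` [set q z] `&` mu_fiber X mu xi) y.
    by split=> //; split=> //; exact: mu_fiber_semistable.
  by rewrite E => -[t tc <-]; exact: uinv.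
rewrite /reduced; set A := (X in get X).
have : A !=set0.
  by exists (u z), z => //; split=> //; split=> //; exact: mu_fiber_semistable.
move=> /getPex[y [[ymu _] yq] <-].
by rewrite (const y ymu yq) (const z zmu erefl).
Qed.

End OrbitsAndFibers.

Section UniformLimit.
Context {R : realType}.

Lemma uniform_near (T : choiceType) (K : set T) (fn : nat -> T -> R) (f : T -> R) (e : R) :
  {uniform K, fn @ \oo --> f} -> 0 < e ->
  exists M, forall n, (M <= n)%N -> forall x, K x -> `|fn n x - f x| < e.
Proof.
move=> cf e0.
have : nbhs (f : {uniform` K -> R}) [set h : T -> R | forall y, K y -> `|f y - h y| < e].
  apply/uniform_nbhs; exists [set xy : R * R | `|xy.1 - xy.2| < e]; split=> //.
  exact: (entourage_ball R (PosNum e0)).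
move=> /cf [M _ hM]; exists M => n Mn x Kx.
by rewrite distrC; exact: hM.
Qed.

End UniformLimit.

(** px, pz, pu and p1 are the values of rho_n at x, at z, at the point of the
    path where rho is rz + eps, and at the end of the path. The case in which
    the maximum is p1 is excluded because p1 is less than pu. *)
Lemma bound_from_maximum {R : realType} (px pz pu p1 rz eps dl delta : R) :
  `|pz - rz| < dl / 2 -> `|pu - (rz + eps)| < dl / 2 -> p1 < pz + eps / 2 ->
  dl <= eps / 2 -> dl <= delta -> pu <= Num.max px p1 ->
  eps - delta <= px - pz.
Proof.
rewrite !ltr_norml le_max => /andP[_ hz] /andP[hu _] h1 he hd /orP[]; lra.
Qed.

Lemma intermediate_value {R : realType} (f : R -> R) (v : R) : continuous f ->
  f 1 <= v -> v <= f 0 -> exists2 u, 0 <= u <= 1 & f u = v.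
Proof.
move=> cf f1 f0; have [|u u01 fu] := IVT (v := v) ler01 (continuous_subspaceT cf).
  by rewrite ge_min f1 orbT le_max f0.
by exists u.
Qed.

Theorem theorem2 (R : realType) (N r : nat)
  (X : set (proj_space R N))
  (X_closed : zclosed X) (X_normal : normal X) (X_pure : pure_dimensional X)
  (act : 'rV[Cx R]_r -> proj_space R N -> proj_space R N)
  (act_alg : algebraic_action X act)
  (L : line_bundle X) (L_bpf : base_point_free L)
  (actL : 'rV[Cx R]_r -> tot L -> tot L) (actL_lin : linearization act actL)
  (nrm : tot L -> R) (nrm_metric : hermitian_metric actL nrm)
  (mu : proj_space R N -> 'rV[R]_r) (mu_moment : moment_map actL nrm mu)
  (xi : 'rV[R]_r) (xi_im : (mu @` X) xi)
  (Y : topologicalType) (q : proj_space R N -> Y)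
  (OY : set Y -> set (Y -> Cx R))
  (q_quot : hilbert_quotient X act mu xi q OY)
  (I : finType) (Xi : I -> set (proj_space R N))
  (s : I -> forall n, section L n) (chi : I -> nat -> 'rV[int]_r)
  (s_tame : tame_collection act actL mu xi q Xi s chi)
  (i : I) (rho : proj_space R N -> R)
  (rho_spsh : smooth_spsh_on (Xi i) rho)
  (rho_cvg : cvg_smooth (Xi i) (fun n => potential nrm (s i n)) rho)
  (W : set Y) (W_compact : compact W) (W_sub : W `<=` q @` Xi i)
  (W_nbhs : exists y : Y, nbhs y W)
  (W_proper : proper_over q (Xi i) (normalized X act mu xi q rho) W)
  (eps : R) (eps_gt0 : 0 < eps) (delta : R) (delta_gt0 : 0 < delta) :
  exists N0 : nat, forall n, (N0 <= n)%N ->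
    forall x, tube_compl q (Xi i) (normalized X act mu xi q rho) eps W x ->
      eps - delta <= normalized X act mu xi q (potential nrm (s i n)) x.
Proof.
have ss_X y : semistable X act mu xi y -> X y by case.
have Xi_ss y : Xi i y -> semistable X act mu xi y.
  by move=> iy; rewrite (tame_cover s_tame); exists i.
have Xi_X y : Xi i y -> X y by move=> /Xi_ss/ss_X.
have Xi_q y z : Xi i y -> semistable X act mu xi z -> q y = q z -> Xi i z.
  by move=> iy; exact: (tame_saturated s_tame).
have act_q t y : torus t -> Xi i y -> q (act t y) = q y.
  by move=> tT /Xi_ss; exact: (quotient_act act mu xi act_alg Y q OY q_quot).
have act_Xi t y : torus t -> Xi i y -> Xi i (act t y).
  move=> tT iy; apply: (Xi_q y) => //; last by rewrite act_q.
  by apply: (semistable_act act mu xi act_alg) => //; exact: Xi_ss.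
pose pot n := potential nrm (s i n).
have pot_inv n t y : ctorus t -> X y -> pot n (act t y) = pot n y.
  exact: (potential_invariant L nrm act actL act_alg actL_lin nrm_metric n (s i n)
    (chi i n) (tame_eigen s_tame i n)).
have ctorusW (t : 'rV[Cx R]_r) : ctorus t -> torus t.
  by move=> tc j; rewrite -modulus_gt0 tc.
have rho_lim y : Xi i y -> (fun n => pot n y) @ \oo --> rho y.
  move=> iy; apply/cvgrPdist_lt => e e0.
  have sub : [set y] `<=` Xi i by move=> _ ->.
  have cy : compact [set y] by exact: compact_set1.
  have [M hM] := uniform_near _ [set y] pot rho e (rho_cvg.1 _ cy sub) e0.
  by exists M => // n Mn; rewrite distrC; exact: hM.
have rho_inv t y : ctorus t -> Xi i y -> rho (act t y) = rho y.
  move=> tc iy; have tT := ctorusW t tc.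
  have l1 := rho_lim _ (act_Xi t y tT iy); have l2 := rho_lim _ iy.
  have E : (fun n => pot n (act t y)) = (fun n => pot n y).
    by apply/funext => n; exact: pot_inv (Xi_X y iy).
  rewrite E in l1.
  by rewrite -(cvg_lim (@Rhausdorff R) l1) (cvg_lim (@Rhausdorff R) l2).
have rho_cont y : Xi i y -> rho @ within (Xi i) (nbhs y) --> rho y.
  move=> iy; apply: (locally_extends_cvg (Xi i) _ rho y _ rho_spsh iy) => Om F [sF _] b Ob.
  by have [cF _] := sF 0%N; exact: cF.
have red_rho z : mu_fiber X mu xi z -> Xi i z -> reduced X act mu xi q rho (q z) = rho z.
  move=> zmu iz; apply: (reducedE act mu xi act_alg Y q OY q_quot (Xi i)) => //.
  by move=> y yss yz; apply: (Xi_q z).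
have red_pot n z : mu_fiber X mu xi z -> reduced X act mu xi q (pot n) (q z) = pot n z.
  move=> zmu; apply: (reducedE act mu xi act_alg Y q OY q_quot X) => //.
    by move=> t y; exact: pot_inv.
  by move=> y /ss_X.
pose nrho := normalized X act mu xi q rho.
pose K := [set y | [/\ Xi i y, W (q y) & (`[0, eps] `*` W) (nrho y, q y)]].
(* K does not depend on x, whence the uniformity in the tube complement. *)
have cK : compact K.
  apply: W_proper; first by apply: compact_setX => //; exact: segment_compact.
  by move=> [a b] [/= a0 Wb]; split=> //=; move: a0; rewrite !in_itv/= => /andP[->].
(* With delta at most eps / 2, a point where rho_n is less than eps / 2 above
   its value at z lies below the level eps - delta. *)
pose dl := Num.min delta (eps / 2).
have dl0 : 0 < dl by rewrite lt_min delta_gt0 divr_gt0.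
have dl_delta : dl <= delta by rewrite ge_min lexx.
have dl_eps : dl <= eps / 2 by rewrite ge_min lexx orbT.
have [N1 hN1] : exists M, forall n, (M <= n)%N -> forall y, K y -> `|pot n y - rho y| < dl / 2.
  apply: uniform_near; last exact: divr_gt0.
  by apply: rho_cvg.1 => // y [].
have [N2 _ hN2] := tame_nonvanishing s_tame i.
exists (maxn (maxn N1 N2) 1) => n; rewrite !geq_max => /andP[/andP[nN1 nN2] n0].
move=> x tx; have [ix Wx xeps] : [/\ Xi i x, W (q x) & eps <= nrho x] := tx.
have Xx := Xi_X x ix.
have nonv y : Xi i y -> nonvanishing (s i n) y by exact: hN2.
have [z [zmu xz zq]] := semistable_limit act mu xi act_alg Y q OY q_quot x (Xi_ss x ix).
have zss := mu_fiber_semistable act mu xi act_alg z zmu.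
have iz : Xi i z by apply: (Xi_q x).
have Xz := Xi_X z iz.
have nrhoE y : q y = q x -> nrho y = rho y - rho z.
  by move=> yq; rewrite /nrho /normalized yq -zq red_rho.
have npotE y : q y = q x -> normalized X act mu xi q (pot n) y = pot n y - pot n z.
  by move=> yq; rewrite /normalized yq -zq red_pot.
(* x is moved along its orbit close to z, n being fixed. *)
have [t tT [rho_t pot_t]] : exists2 t, torus t &
    rho (act t x) < rho z + eps / 2 /\ pot n (act t x) < pot n z + eps / 2.
  have e2 : 0 < eps / 2 by exact: divr_gt0.
  have H1 : \forall y \near z, Xi i y -> rho y < rho z + eps / 2.
    have := cvgr_lt _ (rho_cont z iz) (rho z + eps / 2); rewrite ltrDl => /(_ _ e2).
    by rewrite near_withinE.
  have H2 : \forall y \near z, X y -> pot n y < pot n z + eps / 2.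
    have := cvgr_lt _ (potential_cvg L nrm actL nrm_metric n (s i n) z n0 Xz (nonv z iz))
      (pot n z + eps / 2); rewrite ltrDl => /(_ _ e2).
    by rewrite near_withinE.
  have [_ [[t tT <-] [h1 h2]]] := xz _ (filterI H1 H2).
  exists t => //; split; [apply: h1; exact: act_Xi|apply: h2; exact: (act_stable act_alg tT Xx)].
(* The compact part a of t does not change the potentials, so the noncompact
   part b alone moves x to a point as good as t.x. *)
have [a [b [tE _]]] := torus_polar t tT.
pose g := orbit_path act b x.
have g0 : g 0 = x by exact: (orbit_path0 act act_alg).
have ig u : Xi i (g u) by apply: act_Xi => //; exact: texp_torus.
have gq u : q (g u) = q x by apply: act_q => //; exact: texp_torus.
have g1 : act t x = act (texp (cvec a)) (g 1).
  have i1 : 'i%C * ((1 : R)%:C)%C = 'i%C :> Cx R.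
    by apply/eqP; rewrite eq_complex /=; apply/andP; split; apply/eqP; ring.
  rewrite /g /orbit_path i1 tE texpD.
  by apply: (act_mul act_alg) => //; exact: texp_torus.
have rho_g1 : rho (g 1) < rho z + eps / 2.
  by rewrite -(rho_inv (texp (cvec a)) (g 1) (texp_ctorus a) (ig 1)) -g1.
have pot_g1 : pot n (g 1) < pot n z + eps / 2.
  by rewrite -(pot_inv n (texp (cvec a)) (g 1) (texp_ctorus a) (Xi_X _ (ig 1))) -g1.
have rho_g0 : eps <= rho (g 0) - rho z by rewrite g0 -nrhoE.
have cg : continuous (fun u => rho (g u)).
  exact: (orbit_path_continuous act act_alg rho (Xi i) b x Xx ig rho_cont).
have lower : rho (g 1) <= rho z + eps.
  by rewrite (le_trans (ltW rho_g1))// lerD2l ler_pdivrMr// ler_peMr// ?ler1n// ltW.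
have upper : rho z + eps <= rho (g 0) by rewrite addrC -lerBrDr.
have [u u01 gu] := intermediate_value _ _ cg lower upper.
have Kgu : K (g u).
  split; [exact: ig|by rewrite gq|split; rewrite /= ?gq//].
  by rewrite nrhoE// gu in_itv/= addrAC subrr add0r lexx ltW.
have Kz : K z.
  split; [exact: iz|by rewrite zq|split; rewrite /= ?zq//].
  by rewrite nrhoE// in_itv/= subrr lexx ltW.
have hu := hN1 n nN1 (g u) Kgu; have hz := hN1 n nN1 z Kz.
have pmax := potential_max_at_endpoint L nrm act actL act_alg actL_lin nrm_metric n (s i n)
    (chi i n) (tame_eigen s_tame i n) b x u n0 Xx (fun v => nonv _ (ig v)) u01.
rewrite (orbit_path0 act act_alg b x Xx) in pmax.
rewrite gu in hu; rewrite (npotE x erefl).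
exact: (bound_from_maximum _ _ _ _ _ _ _ _ hz hu pot_g1 dl_eps dl_delta pmax).
Qed.
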